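(* A tangential family germ has a singularity $\mathrm{I}$ (resp., $\mathrm{II}$) if and only if it is of first type (resp., of second type).
   Context: All objects are of class $C^\infty$; a curve means an embedded $1$-submanifold of $\mathbb{R}^2$. Let $(\xi,t)$ be coordinates on the source plane. A map $f$ from the plane to the plane, with $\partial_t f$ vanishing nowhere, parameterizes the $1$-parameter family of plane curves parameterized by $f_\xi:=f(\xi,\cdot)$. The family is called a tangential family if $\partial_\xi f$ and $\partial_t f$ are parallel nonzero vectors at every point $(\xi,t=0)$ and the image of $f(\cdot,0)$ is an embedded curve $\gamma$, called the support of the family. A tangential family germ is the corresponding local object: a map germ $f:(\mathbb{R}^2,0)\to(\mathbb{R}^2,0)$ parameterizing a tangential family. Two map germs $(\mathbb{R}^2,0)\to(\mathbb{R}^2,0)$ are $\mathcal{A}$-equivalent (Left-Right equivalent) if one is obtained from the other, say $f$, as $\psi\circ f\circ\phi^{-1}$, with $\phi,\psi$ diffeomorphism germs of the plane fixing the origin. The singularity of a tangential family germ is its $\mathcal{A}$-equivalence class. Singularity $\mathrm{I}$ is the class of $(\xi,t)\mapsto(\xi+t,t^2)$; singularity $\mathrm{II}$ is the class of $(\xi,t)\mapsto(\xi+t,t^2\xi)$. The graph of the tangential family is the surface $\Phi=\{(q,p): q=f(\xi,0),\ p=f(\xi,t)\}\subset\gamma\times\mathbb{R}^2$ (smooth for a germ), with natural projection $\pi_2:\Phi\to\mathbb{R}^2$, $(q,p)\mapsto p$. The criminant set of the family is the critical set of $\pi_2$. The fiber $\pi_2^{-1}(0,0)$ defines a vertical direction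 in the tangent plane of $\Phi$ at the origin. The branch of the criminant set projecting into the support is non vertical. A tangential family germ is said to be of first type if its criminant set has only one branch, and of second type if its criminant set has exactly two branches, provided that they are smooth, transversal and non vertical.
   Formalization: Branches of the criminant set are counted with multiplicity, as irreducible factors of its Jacobian equation among smooth germs; for the bare critical set the claim fails: (ξ+t, t³) has the single branch t=0 but not singularity I. *)

(* Defs.v *)
From HB Require Import structures.
From mathcomp Require Import all_boot all_order all_algebra.
From mathcomp Require Import all_classical all_reals all_analysis.

Set Implicit Arguments.
Unset Strict Implicit.
Unset Printing Implicit Defensive.

Import Order.TTheory GRing.Theory Num.Theory.
Import numFieldNormedType.Exports.

Local Open Scope classical_set_scope.
Local Open Scope ring_scope.

Notation plane R := 'rV[R]_2.

Definition pt {R : realType} (x y : R) : plane R :=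
  \row_(j < 2) (if j == 0 then x else y).

Section Smooth.
Context {R : realType}.

Fixpoint Ck {V W : normedModType R} (k : nat) (U : set V) (f : V -> W) : Prop :=
  match k with
  | 0 => forall p, U p -> {for p, continuous f}
  | k'.+1 => (forall p, U p -> differentiable f p)
             /\ forall v : V, Ck k' U (fun p => 'D_v f p)
  end.

Definition smooth_on {V W : normedModType R} (U : set V) (f : V -> W) : Prop :=
  forall k, Ck k U f.

(* A germ at the origin is represented by a total function; only its values
   near 0 matter. *)
Definition smooth_germ {V W : normedModType R} (f : V -> W) : Prop :=
  exists2 U : set V, open_nbhs 0 U & smooth_on U f.

Definition map_germ (f : plane R -> plane R) : Prop :=
  smooth_germ f /\ f 0 = 0.

Definition inverse_diffeo_germs (phi phi' : plane R -> plane R) : Prop :=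
  [/\ map_germ phi, map_germ phi',
      (\forall p \near (0 : plane R), phi' (phi p) = p)
    & (\forall p \near (0 : plane R), phi (phi' p) = p)].

Definition A_equivalent (f g : plane R -> plane R) : Prop :=
  exists phi phi' psi psi' : plane R -> plane R,
    [/\ inverse_diffeo_germs phi phi', inverse_diffeo_germs psi psi'
      & \forall p \near (0 : plane R), g p = psi (f (phi' p))].

Definition embedded_curve (S : set (plane R)) : Prop :=
  forall q, S q -> exists (V : set (plane R)) (b : plane R -> R),
    [/\ open_nbhs q V, smooth_on V b,
        (forall p, V p -> exists v, 'd b p v <> 0)
      & S `&` V = [set p | V p /\ b p = 0]].

End Smooth.

Section TangentialFamilies.
Context {R : realType}.
Implicit Types (f : plane R -> plane R) (b : plane R -> R).

Definition d_xi f (p : plane R) : plane R := 'D_(pt 1 0) f p.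
Definition d_t f (p : plane R) : plane R := 'D_(pt 0 1) f p.

Definition tangential_family_germ f : Prop :=
  [/\ map_germ f,
      (\forall p \near (0 : plane R), d_t f p <> 0),
      (\forall x \near (0 : R),
         [/\ d_xi f (pt x 0) <> 0, d_t f (pt x 0) <> 0
           & exists c : R, d_xi f (pt x 0) = c *: d_t f (pt x 0)])
    & exists2 e : R, 0 < e &
        embedded_curve [set f (pt x 0) | x in [set x : R | `|x| < e]]].

Definition normal_form_I (p : plane R) : plane R :=
  pt (p 0 0 + p 0 1) (p 0 1 ^+ 2).
Definition normal_form_II (p : plane R) : plane R :=
  pt (p 0 0 + p 0 1) (p 0 1 ^+ 2 * p 0 0).

Definition singularity_I f : Prop := A_equivalent normal_form_I f.
Definition singularity_II f : Prop := A_equivalent normal_form_II f.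

(* The coordinates (xi, t) are a chart of the graph Phi, whose
   parameterization is an immersion because d_xi f (xi, 0) and d_t f (xi, t)
   do not vanish. *)
Definition graph_param f (p : plane R) : plane R * plane R :=
  (f (pt (p 0 0) 0), f p).

Definition pi2 (z : plane R * plane R) : plane R := z.2.

Definition pi2_chart f : plane R -> plane R := pi2 \o graph_param f.

Definition criminant_set f : set (plane R * plane R) :=
  graph_param f @` [set p | (\rank ('J (pi2_chart f) p) < 2)%N].

Definition criminant_eq f (p : plane R) : R := \det ('J (pi2_chart f) p).

Lemma criminant_setE f :
  criminant_set f = graph_param f @` [set p | criminant_eq f p = 0].
Proof.
congr (_ @` _); apply/seteqP; split => p /=; rewrite /criminant_eq.
  move=> rk; apply/eqP; apply: contraTT rk => d0.
  by rewrite -leqNgt mxrank_unit // unitmxE unitfE.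
move=> /eqP d0; rewrite ltnNge; apply: contraTN d0 => rk.
have : row_full ('J (pi2_chart f) p) by rewrite /row_full eqn_leq rank_leq_col.
by rewrite row_full_unit unitmxE unitfE.
Qed.

(* Branches are irreducible factors, in the ring of smooth function germs, of
   the equation of the criminant set, so they are counted with multiplicity.
   The multiplicity matters: for (xi + t, t^3) the equation is 3 t^2, whose
   zero set {t = 0} is a single smooth curve, though the germ is not
   equivalent to (xi + t, t^2). *)
Definition irreducible_germ b : Prop :=
  [/\ smooth_germ b, b 0 = 0
    & forall a c : plane R -> R, smooth_germ a -> smooth_germ c ->
        (\forall p \near (0 : plane R), b p = a p * c p) ->
        a 0 <> 0 \/ c 0 <> 0].

Definition criminant_branches f (n : nat) (b : 'I_n -> plane R -> R) : Prop :=
  (forall i, irreducible_germ (b i)) /\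
  exists u : plane R -> R,
    [/\ smooth_germ u, u 0 <> 0
      & \forall p \near (0 : plane R),
          criminant_eq f p = u p * \prod_(i < n) b i p].

(* Tangent vectors of Phi live in the ambient space plane * plane. *)
Definition graph_tangent f : set (plane R * plane R) :=
  range ('d (graph_param f) (0 : plane R)).

(* The fiber over the origin of gamma * plane -> plane is gamma * {0}; its
   tangent line at the origin lies in the tangent plane of Phi, where it is the
   kernel of the differential of pi2 (pi2 being linear). *)
Definition vertical_direction f : set (plane R * plane R) :=
  [set w | graph_tangent f w /\ pi2 w = 0].

Definition smooth_branch b : Prop := exists v, 'd b (0 : plane R) v <> 0.

Definition branch_tangent f b : set (plane R * plane R) :=
  'd (graph_param f) (0 : plane R) @` [set v | 'd b (0 : plane R) v = 0].

Definition transversal_branches f b1 b2 : Prop :=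
  graph_tangent f =
  [set w | exists w1 w2, [/\ branch_tangent f b1 w1, branch_tangent f b2 w2
                           & w = w1 + w2]].

Definition vertical_branch f b : Prop :=
  branch_tangent f b = vertical_direction f.

Definition first_type f : Prop :=
  exists b : 'I_1 -> plane R -> R, criminant_branches f b.

Definition second_type f : Prop :=
  exists b : 'I_2 -> plane R -> R,
    [/\ criminant_branches f b,
        (forall i, smooth_branch (b i)),
        transversal_branches f (b 0) (b 1)
      & forall i, ~ vertical_branch f (b i)].

End TangentialFamilies.

(* Main.v *)
Require Import Defs.
From mathcomp Require Import all_boot all_order all_algebra.
From mathcomp Require Import all_classical all_reals all_analysis.
From mathcomp Require Import ring lra.

(** Why the theorem holds.

    A diffeomorphism of the target flattens the support and the first component
    becomes a coordinate of the source: near the origin every tangential family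
    is A-equivalent to a map (x, t^2 H (x, t)) ([prenormalize]).  The equation of
    its criminant set, the Jacobian determinant, is t K with
    K = 2 H + t H_t.  Jacobian determinants of A-equivalent germs agree up to
    pullback and a nonvanishing factor ([criminant_transfer]), so the types can
    be read off from K.

    First type.  The germ t K is irreducible exactly when K, or equivalently H,
    does not vanish at the origin.  Then t^2 H / H (0) is the square of a new
    coordinate s, and (x, s^2) is the normal form ([prenormal_fold]): a fold.

    Second type.  Comparing t K with a product of two equations of smooth,
    transversal, nonvertical branches up to second order gives H = 0, H_x <> 0
    and H_t <> 0 at the origin ([II_of_second_type]).  After changes of
    coordinates the curve K = 0 is the diagonal t = x, and F = t^2 H has the
    same critical points in t and the same critical values as the cubic
    N = t^2 (3 x / 2 - t).  Their difference is then divisible by the square of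
    dN/dt, and correcting t by a multiple of dN/dt turns F into N: the
    coefficient solves a scalar equation to which the implicit function theorem
    applies ([beaks_of_diagonal], [prenormal_beaks]).  The map (x, N) is the
    second normal form up to linear changes of coordinates.

    Conversely, the types of the two normal forms are computed directly, and the
    branches of f are the pullbacks of theirs ([first_type_of_I],
    [second_type_of_II]).

    Two tools of differential calculus carry these arguments: the implicit
    function theorem with smooth dependence ([implicit_function]) and smooth
    division by a power of a coordinate ([hadamard]).  Both are proved by
    expressing the derivatives of the new function through functions of the same
    kind, so that one order of differentiability gives all the others. *)

Set Implicit Arguments.
Unset Strict Implicit.
Unset Printing Implicit Defensive.

Import Order.TTheory GRing.Theory Num.Theory.
Import numFieldNormedType.Exports.

Local Open Scope classical_set_scope.
Local Open Scope ring_scope.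

(** * Calculus of finite order of smoothness *)

Section Calculus.
Context {R : realType}.
Implicit Types V W M : normedModType R.

(** Continuous linear maps, recorded through the property that is used of them:
    such a map is its own differential at every point. *)
Definition clin {V W} (l : V -> W) := forall p : V, is_diff p l l.

Lemma clinP {V W} (l : {linear V -> W}) : continuous l -> clin l.
Proof.
move=> cl p; apply: DiffDef; first exact: linear_differentiable.
exact: diff_lin.
Qed.

Lemma clin_differentiable {V W} (l : V -> W) p : clin l -> differentiable l p.
Proof. by move=> /(_ p) []. Qed.

Lemma clin_derive {V W} (l : V -> W) p v : clin l -> 'D_v l p = l v.
Proof. by move=> /(_ p) [dl e]; rewrite deriveE // e. Qed.

Lemma derive_comp {V M W} (f : V -> M) (g : M -> W) p v :
  differentiable f p -> differentiable g (f p) ->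
  'D_v (g \o f) p = 'd g (f p) ('D_v f p).
Proof.
move=> df dg; rewrite !deriveE //; last exact: differentiable_comp.
by rewrite diff_comp.
Qed.

Lemma derive_clin_comp {V M W} (f : V -> M) (l : M -> W) p v :
  clin l -> differentiable f p -> 'D_v (l \o f) p = l ('D_v f p).
Proof.
by move=> cl df; case: (cl (f p)) => dl le; rewrite derive_comp // le.
Qed.

(** Differentiability by an explicit estimate; the limits below are all
    obtained from inequalities rather than from Landau symbols. *)
Lemma is_diff_eps {V W} (f : V -> W) (l : {linear V -> W}) p : continuous l ->
  (forall e : R, 0 < e ->
     \forall q \near p, `|f q - f p - l (q - p)| <= e * `|q - p|) ->
  is_diff p f l.
Proof.
move=> cl H.
have E : f \o shift p = cst (f p) + l +o_ 0 id.
  apply: eqaddoE; apply/eqaddoP => e e0.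
  have := H e e0; rewrite (near_shift 0) /=; apply: filterS => h.
  by rewrite /= !fctE /= subr0 addrK opprD addrA.
have dl := diff_unique cl E.
apply: DiffDef => //; apply/diff_locallyP; rewrite dl; split=> //.
Qed.

Lemma diff_epsP {V W} (f : V -> W) p : differentiable f p ->
  forall e : R, 0 < e ->
     \forall q \near p, `|f q - f p - 'd f p (q - p)| <= e * `|q - p|.
Proof.
move=> /diff_locallyP[cd H] e e0.
have := (eqaddoP _ _ _ _ ).1 (eqaddoE H) e e0.
rewrite near_simpl (near_shift p 0) /=; apply: filterS => q /=.
by rewrite /= !fctE /= sub0r subrK opprD addrA.
Qed.

Lemma near_differentiable {V W} (f g : V -> W) p :
  (\forall q \near p, f q = g q) -> differentiable f p -> differentiable g p.
Proof.
move=> fg df; have fgp := nbhs_singleton fg.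
suff : is_diff p g ('d f p) by case.
apply: is_diff_eps; first exact: diff_continuous.
move=> e e0; have := diff_epsP df e0; apply: filterS2 fg => q <-.
by rewrite fgp.
Qed.

Lemma eq_near_open {V} (T : Type) (U : set V) (f g : V -> T) p : open U -> U p ->
  (forall q, U q -> f q = g q) -> \forall q \near p, f q = g q.
Proof.
by move=> oU Up fg; apply: filterS (open_nbhs_nbhs (conj oU Up)) => q Uq; apply: fg.
Qed.

Lemma Ck_continuous {V W} k (U : set V) (f : V -> W) p :
  Ck k U f -> U p -> {for p, continuous f}.
Proof.
case: k => [|k] /=; first by move=> H /H.
by move=> [H _] /H /differentiable_continuous.
Qed.

Lemma Ck_eq {V W} k (U : set V) (f g : V -> W) : open U ->
  (forall q, U q -> f q = g q) -> Ck k U f -> Ck k U g.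
Proof.
move=> oU; elim: k f g => [|k IH] f g fg /=.
  move=> cf p Up; have := cf p Up; rewrite /prop_for /continuous_at -(fg p Up).
  by apply: cvg_trans; apply: near_eq_cvg; exact: eq_near_open fg.
move=> [df Df]; split.
  move=> p Up; apply: near_differentiable (df p Up); exact: eq_near_open fg.
move=> v; apply: IH (Df v) => p Up; apply: near_eq_derive.
exact: eq_near_open fg.
Qed.

Lemma Ck_sub {V W} k (U U' : set V) (f : V -> W) :
  U' `<=` U -> Ck k U f -> Ck k U' f.
Proof.
move=> sU; elim: k f => [|k IH] f /=; first by move=> H p /sU /H.
by move=> [H1 H2]; split=> [p /sU /H1 //|v]; apply: IH.
Qed.

Lemma Ck_pred {V W} k (U : set V) (f : V -> W) : Ck k.+1 U f -> Ck k U f.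
Proof.
elim: k f => [|k IH] f; last by move=> [H1 H2]; split=> // v; exact: IH.
by move=> [H _] p /H /differentiable_continuous.
Qed.

Lemma Ck_cst {V W} k (U : set V) (c : W) : Ck k U (fun=> c).
Proof.
elim: k c => [|k IH] c /=; first by move=> p _; exact: cvg_cst.
split=> [p _|v]; first exact: differentiable_cst.
have -> : (fun p : V => 'D_v (fun=> c) p) = fun=> 0; last exact: IH.
by apply/funext => p; exact: derive_cst.
Qed.

Lemma Ck_clin {V W} k (U : set V) (l : V -> W) : clin l -> Ck k U l.
Proof.
move=> cl; case: k => [|k] /=.
  by move=> p _; apply: differentiable_continuous; exact: clin_differentiable.
split=> [p _|v]; first exact: clin_differentiable.
have -> : (fun p : V => 'D_v l p) = fun=> l v; last exact: Ck_cst.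
by apply/funext => p; rewrite clin_derive.
Qed.

Lemma Ck_clin_comp {V M W} k (U : set V) (f : V -> M) (l : M -> W) : open U ->
  clin l -> Ck k U f -> Ck k U (l \o f).
Proof.
move=> oU cl; elim: k f => [|k IH] f /=.
  move=> cf p Up; apply: continuous_comp; first exact: cf.
  by apply: differentiable_continuous; exact: clin_differentiable.
move=> [df Df]; split=> [p Up|v].
  by apply: differentiable_comp; [exact: df|exact: clin_differentiable].
apply: Ck_eq (IH _ (Df v)) => // p Up /=.
by rewrite derive_clin_comp //; exact: df.
Qed.

Lemma Ck_add {V W} k (U : set V) (f g : V -> W) : open U ->
  Ck k U f -> Ck k U g -> Ck k U (fun p => f p + g p).
Proof.
move=> oU; elim: k f g => [|k IH] f g /=.
  by move=> cf cg p Up; apply: continuousD; [exact: cf|exact: cg].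
move=> [df Df] [dg Dg]; split=> [p Up|v].
  by apply: differentiableD; [exact: df|exact: dg].
apply: Ck_eq (IH _ _ (Df v) (Dg v)) => // p Up.
by rewrite deriveD //; apply: diff_derivable; [exact: df|exact: dg].
Qed.

Lemma Ck_sum {V W} k (U : set V) n (f : 'I_n -> V -> W) : open U ->
  (forall i, Ck k U (f i)) -> Ck k U (fun p => \sum_(i < n) f i p).
Proof.
move=> oU; elim: n f => [|n IH] f H.
  apply: (@Ck_eq _ _ k U (fun=> 0)) => //; last exact: Ck_cst.
  by move=> q _; rewrite big_ord0.
apply: (@Ck_eq _ _ k U (fun p => f ord0 p + \sum_(i < n) f (lift ord0 i) p)) => //.
  by move=> q _; rewrite big_ord_recl.
by apply: Ck_add => //; apply: IH => i; exact: H.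
Qed.

Lemma Ck_mul {V} k (U : set V) (f g : V -> R) : open U ->
  Ck k U f -> Ck k U g -> Ck k U (fun p => f p * g p).
Proof.
move=> oU; elim: k f g => [|k IH] f g.
  by move=> cf cg p Up; apply: continuousM; [exact: cf|exact: cg].
move=> Cf Cg; have := Ck_pred Cf; have := Ck_pred Cg.
case: Cf Cg => [df Df] [dg Dg] Cg Cf; split=> [p Up|v].
  by apply: differentiableM; [exact: df|exact: dg].
apply: Ck_eq (Ck_add oU (IH _ _ Cf (Dg v)) (IH _ _ Cg (Df v))) => // p Up.
by rewrite deriveM //; apply: diff_derivable; [exact: df|exact: dg].
Qed.

Lemma clin_scale {V} (e : V) : clin (fun r : R => r *: e).
Proof. by move=> p; exact: is_diff_scalel. Qed.

Lemma clin_mul (r : R) : clin (fun x : R => r * x).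
Proof. by move=> p; exact: (@is_diff_scaler _ R^o). Qed.

Lemma Ck_opp {V W} k (U : set V) (f : V -> W) : open U ->
  Ck k U f -> Ck k U (fun p => - f p).
Proof.
move=> oU; apply: (@Ck_clin_comp V W W k U f -%R) => // p.
by apply: DiffDef; [exact: differentiableN|rewrite diffN // diff_val].
Qed.

(** The derivative of 1/f is - (1/f)^2 Df, so each order for 1/f needs only
    the previous order for 1/f itself. *)
Lemma Ck_inv {V} k (U : set V) (f : V -> R) : open U ->
  (forall p, U p -> f p != 0) -> Ck k U f -> Ck k U (fun p => (f p)^-1).
Proof.
move=> oU f0; elim: k => [|k IH].
  by move=> cf p Up; apply: continuousV; [exact: f0|exact: cf].
move=> Cf; have CV := IH (Ck_pred Cf).
case: Cf => [df Df]; split=> [p Up|v].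
  by apply: differentiableV; [exact: df|exact: f0].
apply: Ck_eq (Ck_opp oU (Ck_mul oU (Ck_mul oU CV CV) (Df v))) => // p Up.
rewrite deriveV //; [|exact: f0|by apply: diff_derivable; exact: df].
by rewrite scaleNr -expr2 exprVn.
Qed.

(** A basis of M with its dual coordinates. *)
Definition frame M n (e : 'I_n -> M) (l : 'I_n -> M -> R) :=
  (forall i, clin (l i)) /\ forall m, m = \sum_i l i m *: e i.

Lemma derive_frame {V M} n (e : 'I_n -> M) l (f : V -> M) (g : M -> R) p v :
  frame e l -> differentiable f p -> differentiable g (f p) ->
  'D_v (g \o f) p = \sum_i 'D_v (l i \o f) p * 'D_(e i) g (f p).
Proof.
move=> [cl le] df dg; rewrite derive_comp // [X in 'd g _ X]le linear_sum.
apply: eq_bigr => i _; rewrite linearZ /= -[_ *: _]/(_ * _).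
by rewrite (derive_clin_comp _ (cl i) df) (deriveE _ dg).
Qed.

(** [Ck] differentiates in constant directions, while the chain rule produces
    the derivative of g in the direction 'D_v f p, which moves with p.
    Expanded in a frame, that derivative is a finite sum of products of
    functions of order one less, and the induction on k goes through. *)
Lemma Ck_comp {V M} n (e : 'I_n -> M) l k (U : set V) (U' : set M)
    (f : V -> M) (g : M -> R) : frame e l -> open U ->
  (forall p, U p -> U' (f p)) -> Ck k U f -> Ck k U' g -> Ck k U (g \o f).
Proof.
move=> fr oU sU; elim: k f g sU => [|k IH] f g sU.
  move=> cf cg p Up; apply: continuous_comp; first exact: cf.
  by apply: cg; exact: sU.
move=> Cf [dg Dg]; have Cf' := Ck_pred Cf; case: Cf => df Df.
split=> [p Up|v].
  by apply: differentiable_comp; [exact: df|apply: dg; exact: sU].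
apply: (@Ck_eq _ _ k U
  (fun p => \sum_i (l i \o (fun p => 'D_v f p)) p
                    * ((fun m => 'D_(e i) g m) \o f) p)) => //.
  move=> q Uq; rewrite (derive_frame v fr (df q Uq) (dg _ (sU _ Uq))).
  by apply: eq_bigr => i _; rewrite (derive_clin_comp _ (fr.1 i) (df q Uq)).
apply: Ck_sum => // i; apply: Ck_mul => //; last exact: (IH _ _ sU Cf' (Dg (e i))).
have [cl _] := fr.
exact: (@Ck_clin_comp V M R k U (fun p => 'D_v f p) (l i) oU (cl i) (Df v)).
Qed.

Lemma pt0 (x y : R) : pt x y 0 0 = x. Proof. by rewrite mxE. Qed.
Lemma pt1 (x y : R) : pt x y 0 1 = y. Proof. by rewrite mxE. Qed.
Definition ptE := (pt0, pt1).

Lemma plane_ext (p q : plane R) : p 0 0 = q 0 0 -> p 0 1 = q 0 1 -> p = q.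
Proof.
move=> h0 h1; apply/matrixP => i j; rewrite !ord1.
case: j => [[|[|//]]] jp.
  by rewrite (_ : Ordinal jp = 0) //; exact: val_inj.
by rewrite (_ : Ordinal jp = 1) //; exact: val_inj.
Qed.

Lemma pt_eta (p : plane R) : pt (p 0 0) (p 0 1) = p.
Proof. by apply: plane_ext; rewrite ptE. Qed.

Lemma pt00 : pt 0 0 = 0 :> plane R.
Proof. by apply: plane_ext; rewrite ptE mxE. Qed.

Lemma ptD (a b c d : R) : pt a b + pt c d = pt (a + c) (b + d).
Proof. by apply: plane_ext; rewrite mxE !ptE. Qed.

Lemma ptZ (a b c : R) : c *: pt a b = pt (c * a) (c * b).
Proof. by apply: plane_ext; rewrite mxE !ptE. Qed.

Lemma clin_coord j : clin (fun p : plane R => p 0 j).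
Proof.
have @f : {linear plane R -> R}.
  by exists (fun N : plane R => N 0 j); do 2![eexists]; do ?[constructor];
     rewrite ?mxE// => ? *; rewrite ?mxE//; move=> ?; rewrite !mxE.
by apply: (@clinP _ _ f); exact: coord_continuous.
Qed.

Definition ebase (i : 'I_2) : plane R := pt (i == 0)%:R (i == 1)%:R.

Lemma frame_plane : frame ebase (fun i (p : plane R) => p 0 i).
Proof.
split=> [i|p]; first exact: clin_coord.
rewrite !big_ord_recl big_ord0 addr0 /ebase !ptZ ptD /=.
rewrite !mulr0 !mulr1 addr0 add0r -[LHS]pt_eta.
by congr pt; congr (p 0 _); apply: val_inj.
Qed.

Lemma derive_plane {V} (f : V -> plane R) (g : plane R -> R) p v :
  differentiable f p -> differentiable g (f p) ->
  'D_v (g \o f) p = 'D_v (fun q => f q 0 0) p * 'D_(pt 1 0) g (f p)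
                  + 'D_v (fun q => f q 0 1) p * 'D_(pt 0 1) g (f p).
Proof.
move=> df dg; rewrite (derive_frame _ frame_plane) // !big_ord_recl big_ord0 addr0.
rewrite /ebase /=; have -> : lift ord0 ord0 = 1 :> 'I_2 by apply: val_inj.
by [].
Qed.

Lemma Ck_coord {V} k (U : set V) (f : V -> plane R) j : open U ->
  Ck k U f -> Ck k U (fun p => f p 0 j).
Proof. by move=> oU; exact: (@Ck_clin_comp _ _ _ k U f _ oU (clin_coord j)). Qed.

Lemma pt_decomp {V} (a b : V -> R) :
  (fun p => pt (a p) (b p)) =
  (fun p => ((fun r : R => r *: (pt 1 0 : plane R)) \o a) p
          + ((fun r : R => r *: (pt 0 1 : plane R)) \o b) p).
Proof. by apply/funext => p /=; rewrite !ptZ ptD !mulr0 !mulr1 addr0 add0r. Qed.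

Lemma Ck_pt {V} k (U : set V) (a b : V -> R) : open U ->
  Ck k U a -> Ck k U b -> Ck k U (fun p => pt (a p) (b p)).
Proof.
move=> oU Ca Cb; rewrite pt_decomp.
by apply: Ck_add => //; apply: Ck_clin_comp => //; exact: clin_scale.
Qed.

Lemma differentiable_pt {V} (a b : V -> R) p :
  differentiable a p -> differentiable b p ->
  differentiable (fun q => pt (a q) (b q)) p.
Proof.
move=> da db; rewrite pt_decomp; apply: differentiableD.
  by apply: differentiable_comp => //; apply: clin_differentiable; exact: clin_scale.
by apply: differentiable_comp => //; apply: clin_differentiable; exact: clin_scale.
Qed.

Lemma derive_coord {V} (f : V -> plane R) p v j : differentiable f p ->
  ('D_v f p) 0 j = 'D_v (fun q => f q 0 j) p.
Proof.
by move=> df; rewrite -(derive_clin_comp _ (clin_coord j)).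
Qed.

Lemma clin_fst {V W} : clin (@fst V W).
Proof. by apply: (@clinP (V * W)%type V fst) => p; exact: cvg_fst. Qed.

Lemma clin_snd {V W} : clin (@snd V W).
Proof. by apply: (@clinP (V * W)%type W snd) => p; exact: cvg_snd. Qed.

Lemma clin_comp {V M W} (k : V -> M) (l : M -> W) : clin k -> clin l -> clin (l \o k).
Proof. by move=> ck cl p; apply: is_diff_comp. Qed.

Lemma clin_pair {V M W} (k : V -> M) (l : V -> W) :
  clin k -> clin l -> clin (fun p => (k p, l p)).
Proof. by move=> ck cl p; apply: is_diff_pair. Qed.

Lemma clin_cst0 {V W} : clin (fun _ : V => 0 : W).
Proof. by move=> p; apply: is_diff_cst. Qed.

Lemma clin_id {V} : clin (fun p : V => p).
Proof. by move=> p; apply: is_diff_id. Qed.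

(** A frame of plane * R, the space where the implicit function theorem puts
    its equation. *)
Definition ebase3 (i : 'I_3) : plane R * R :=
  nth 0 [:: (pt 1 0, 0); (pt 0 1, 0); (0, 1)] i.
Definition ecoord3 (i : 'I_3) (m : plane R * R) : R :=
  nth 0 [:: m.1 0 0; m.1 0 1; m.2] i.

Lemma frame_plane_line : frame ebase3 ecoord3.
Proof.
split=> [i|[p s]].
  rewrite /ecoord3; case: i => [[|[|[|//]]] ip] /=; last exact: clin_snd.
    exact: (clin_comp clin_fst (clin_coord 0)).
  exact: (clin_comp clin_fst (clin_coord 1)).
rewrite !big_ord_recl big_ord0 addr0 /ebase3 /ecoord3 /=.
rewrite -{1}(pt_eta p); congr pair => /=.
  by rewrite !ptZ scaler0 addr0 ptD !mulr0 !mulr1 addr0 add0r.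
by rewrite !scaler0 !add0r -[RHS]/(_ * _) mulr1.
Qed.

End Calculus.

(** * Mean values and symmetry of second derivatives *)

Section MeanValue.
Context {R : realType}.
Implicit Types V W M : normedModType R.

Lemma near_normP {V} (p : V) (P : V -> Prop) :
  (\forall q \near p, P q) <->
  exists2 r : R, 0 < r & forall q, `|q - p| < r -> P q.
Proof.
split=> [/nbhs_normP[r r0 H]|[r r0 H]].
  by exists r => // q qr; apply: H => /=; rewrite distrC.
by apply/nbhs_normP; exists r => // q /= qr; apply: H; rewrite distrC.
Qed.

Lemma is_derive_line {V W} (f : V -> W) p v (s : R) :
  differentiable f (p + s *: v) ->
  is_derive s 1 (fun a : R => f (p + a *: v)) ('D_v f (p + s *: v)).
Proof.
move=> df; pose g (a : R) := p + a *: v.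
have dg : is_diff s g (fun a : R => a *: v).
  have -> : (fun a : R => a *: v) = (fun=> 0) + (fun a : R => a *: v).
    by apply/funext => a; rewrite !fctE add0r.
  by apply: is_diffD.
have dc : differentiable (f \o g) s by apply: differentiable_comp.
apply: DeriveDef; first by apply: (@diff_derivable _ _ _ (f \o g)).
rewrite -[LHS]/('D_1 (f \o g) s) deriveE // diff_comp //= deriveE //.
by rewrite diff_val scale1r.
Qed.

Lemma MVT_ray {V} (f : V -> R) p v (t : R) : 0 <= t ->
  (forall s : R, 0 <= s <= t -> differentiable f (p + s *: v)) ->
  exists2 s : R, 0 <= s <= t & f (p + t *: v) - f p = t * 'D_v f (p + s *: v).
Proof.
move=> t0 df; pose g (a : R) := f (p + a *: v).
have dg (s : R) : 0 <= s <= t -> is_derive s 1 g ('D_v f (p + s *: v)).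
  by move=> st; apply: is_derive_line; exact: df.
have cg : {within `[0, t], continuous g}.
  apply: continuous_in_subspaceT => s; rewrite inE /= in_itv /= => sab.
  apply: differentiable_continuous; apply/derivable1_diffP.
  by have [] := dg s sab.
have dg' (s : R) : s \in `]0, t[ -> is_derive s 1 g ('D_v f (p + s *: v)).
  by rewrite in_itv /= => /andP[h1 h2]; apply: dg; rewrite !ltW.
have [s st] := @MVT_segment R g _ 0 t t0 dg' cg.
rewrite /g scale0r addr0 subr0 mulrC => E; exists s => //.
Qed.

Lemma MVT_line {V} (f : V -> R) p v (t : R) :
  (forall s : R, `|s| <= `|t| -> differentiable f (p + s *: v)) ->
  exists2 s : R, `|s| <= `|t| & f (p + t *: v) - f p = t * 'D_v f (p + s *: v).
Proof.
move=> df; have [t0|t0] := leP 0 t.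
  have [s|s /andP[s0 st] E] := @MVT_ray V f p v t t0.
    by move=> /andP[s0 st]; apply: df; rewrite !ger0_norm.
  by exists s => //; rewrite !ger0_norm.
have nt0 : 0 <= - t by rewrite oppr_ge0 ltW.
have H (s : R) : 0 <= s <= - t -> `|t + s| <= `|t|.
  by move=> /andP[s0 st]; rewrite (ltr0_norm t0) ler_norml opprK lerDl s0 /=; lra.
have [s|s st E] := @MVT_ray V f (p + t *: v) v (- t) nt0.
  by move=> /H st; rewrite -addrA -scalerDl; exact: df.
exists (t + s); first exact: H.
rewrite -addrA -scalerDl subrr scale0r addr0 -addrA -scalerDl in E.
by rewrite -opprB E mulNr opprK.
Qed.

Lemma derive_translate {V W} (f : V -> W) c p v :
  differentiable f (p + c) -> 'D_v (fun q => f (q + c)) p = 'D_v f (p + c).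
Proof.
move=> df; pose g (q : V) := q + c.
have dg : is_diff p g (fun q => q).
  have -> : (fun q : V => q) = (fun q => q) + (fun=> 0).
    by apply/funext => a; rewrite !fctE addr0.
  by apply: is_diffD.
rewrite -[LHS]/('D_v (f \o g) p) deriveE; last exact: differentiable_comp.
by rewrite diff_comp // deriveE //= diff_val.
Qed.

Lemma differentiable_translate {V W} (f : V -> W) c p :
  differentiable f (p + c) -> differentiable (fun q => f (q + c)) p.
Proof.
move=> df; apply: (@differentiable_comp _ _ _ _ (fun q => q + c) f) => //.
Qed.

(** Two applications of the mean value theorem, first along v to the increment
    of f in the direction w, then along w to the derivative 'D_v f. *)
Lemma second_difference {V} (U : set V) (f : V -> R) p v w (s : R) :
  (forall a b : R, `|a| <= `|s| -> `|b| <= `|s| -> U (p + a *: v + b *: w)) ->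
  Ck 2 U f ->
  exists a b : R, [/\ `|a| <= `|s|, `|b| <= `|s| &
    f (p + s *: v + s *: w) - f (p + s *: v) - (f (p + s *: w) - f p)
    = s * (s * 'D_w (fun q => 'D_v f q) (p + a *: v + b *: w))].
Proof.
move=> HU [df D2].
have Hd (a b : R) : `|a| <= `|s| -> `|b| <= `|s| -> differentiable f (p + a *: v + b *: w).
  by move=> ha hb; apply: df; exact: HU.
have n0 : `|0 : R| <= `|s| by rewrite normr0.
have Hd0 (a : R) : `|a| <= `|s| -> differentiable f (p + a *: v).
  by move=> ha; have := Hd a 0 ha n0; rewrite scale0r addr0.
pose g q := f (q + s *: w) - f q.
have [a ha E] : exists2 a : R, `|a| <= `|s| &
    g (p + s *: v) - g p = s * 'D_v g (p + a *: v).
  apply: MVT_line => a ha; apply: differentiableB; last exact: Hd0.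
  by apply: differentiable_translate; exact: Hd.
have [b hb E2] : exists2 b : R, `|b| <= `|s| &
   'D_v f (p + a *: v + s *: w) - 'D_v f (p + a *: v)
     = s * 'D_w (fun q => 'D_v f q) (p + a *: v + b *: w).
  apply: (@MVT_line _ (fun q => 'D_v f q)) => b hb; have [+ _] := D2 v; apply; exact: HU.
exists a, b; split=> //; rewrite -E2.
rewrite -[LHS]/(g (p + s *: v) - g p) E; congr (_ * _).
rewrite /g deriveB ?derive_translate //.
- exact: Hd.
- by apply: diff_derivable; apply: differentiable_translate; exact: Hd.
- by apply: diff_derivable; exact: Hd0.
Qed.

(** The second difference of f along v and w does not see the order of v and
    w, and by [second_difference] it is s^2 times either mixed derivative at
    some point near p; continuity brings these points to p. *)
Lemma derive_symmetric {V} (U : set V) (f : V -> R) p v w : open U -> U p ->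
  Ck 2 U f -> 'D_v (fun q => 'D_w f q) p = 'D_w (fun q => 'D_v f q) p.
Proof.
move=> oU Up C2.
have cA : {for p, continuous (fun q => 'D_w (fun q => 'D_v f q) q)}.
  by have [_ /(_ v) [_ /(_ w)]] := C2; apply.
have cB : {for p, continuous (fun q => 'D_v (fun q => 'D_w f q) q)}.
  by have [_ /(_ w) [_ /(_ v)]] := C2; apply.
set A := (fun q => 'D_w (fun q => 'D_v f q) q) in cA *.
set B := (fun q => 'D_v (fun q => 'D_w f q) q) in cB *.
suff : forall e : R, 0 < e -> `|B p - A p| <= e + e.
  move=> H; apply/eqP; rewrite -subr_eq0 -normr_eq0; apply/eqP.
  apply/le_anti; rewrite normr_ge0 andbT; apply/ler_addgt0Pr => e e0.
  have e2 : 0 < e / 2 by rewrite divr_gt0.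
  by rewrite add0r (le_trans (H _ e2)) // -splitr.
move=> e e0.
have /near_normP[r r0 Hr] : \forall q \near p,
    [/\ U q, `|A p - A q| < e & `|B p - B q| < e].
  have hU : \forall q \near p, U q by exact: open_nbhs_nbhs.
  have hA : \forall q \near p, `|A p - A q| < e.
    by move/cvgrPdist_lt : cA => /(_ e e0).
  have hB : \forall q \near p, `|B p - B q| < e.
    by move/cvgrPdist_lt : cB => /(_ e e0).
  by apply: filterS3 hU hA hB => q.
pose N := `|v| + `|w| + 1; have N0 : 0 < N by rewrite /N ltr_wpDl // addr_ge0.
pose s := r / N; have s0 : 0 < s by rewrite divr_gt0.
have sN : s * (`|v| + `|w|) < r.
  rewrite -[ltRHS](divfK (lt0r_neq0 N0)) -/s ltr_pM2l // /N ltrDl //.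
have HR (a b : R) : `|a| <= `|s| -> `|b| <= `|s| -> `|p + a *: v + b *: w - p| < r.
  rewrite (gtr0_norm s0) => ha hb; apply: le_lt_trans sN.
  rewrite -[p + _ + _]addrA [p + _]addrC addrK (le_trans (ler_normD _ _)) // !normrZ mulrDr.
  by apply: lerD; apply: ler_wpM2r.
have HU (a b : R) : `|a| <= `|s| -> `|b| <= `|s| -> U (p + a *: v + b *: w).
  by move=> ha hb; have [] := Hr _ (HR a b ha hb).
have HU' (a b : R) : `|a| <= `|s| -> `|b| <= `|s| -> U (p + a *: w + b *: v).
  by move=> ha hb; rewrite addrAC; exact: HU.
have [a [b [ha hb E]]] := second_difference HU C2.
have [a' [b' [ha' hb' E']]] := second_difference HU' C2.
have : s * (s * A (p + a *: v + b *: w)) = s * (s * B (p + a' *: w + b' *: v)).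
  apply: etrans (esym E) _; apply: etrans _ E'; rewrite (addrAC p (s *: w)).
  by move: (f _) (f _) (f _) (f _) => x1 x2 x3 x4; ring.
move/(mulfI (lt0r_neq0 s0))/(mulfI (lt0r_neq0 s0)) => AB.
have [_ hA _] := Hr _ (HR a b ha hb).
have [_ _ hB] := Hr _ (HR b' a' hb' ha').
rewrite addrAC -AB in hB.
have -> : B p - A p = (B p - A (p + a *: v + b *: w)) - (A p - A (p + a *: v + b *: w)).
  by move: (A _) (B _) (A _) => x1 x2 x3; ring.
by apply: le_trans (ler_normB _ _) _; apply: lerD; [exact: ltW hB|exact: ltW hA].
Qed.

End MeanValue.

(** * The implicit function theorem *)

Section ImplicitFunction.
Context {R : realType}.
Implicit Types V W M : normedModType R.

Lemma is_diff_clin {V W} (f l : V -> W) p : clin l ->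
  (forall e : R, 0 < e ->
     \forall q \near p, `|f q - f p - l (q - p)| <= e * `|q - p|) ->
  is_diff p f l.
Proof.
move=> cl; have [dl le] := cl 0; rewrite -le => H.
by apply: is_diff_eps H; exact: diff_continuous.
Qed.

Lemma clin_bound {V W} (l : V -> W) : clin l ->
  exists2 C : R, 0 < C & forall v, `|l v| <= C * `|v|.
Proof.
move=> cl; have [dl le] := cl 0; rewrite -le.
exact: linear_lipschitz (diff_continuous dl).
Qed.

Lemma clin_diff {V W} (f : V -> W) p : differentiable f p -> clin ('d f p).
Proof. by move=> df; apply: clinP; exact: diff_continuous. Qed.

Lemma prod_norm_lt {V W} (p : V) (q : W) (r : R) :
  (`|(p, q)| < r) = (`|p| < r) && (`|q| < r).
Proof. by rewrite prod_normE gt_max. Qed.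

Lemma prod_norm_le_sum {V W} (p : V) (q : W) : `|(p, q)| <= `|p| + `|q|.
Proof. by rewrite prod_normE ge_max lerDl lerDr !normr_ge0. Qed.

Lemma Ck_pair {V M W} k (U : set V) (a : V -> M) (b : V -> W) : open U ->
  Ck k U a -> Ck k U b -> Ck k U (fun p => (a p, b p)).
Proof.
move=> oU Ca Cb; apply: (@Ck_eq _ _ _ k U
    (fun p => ((fun m => (m, 0 : W)) \o a) p + ((fun m => (0 : M, m)) \o b) p)) => //.
  by move=> p _ /=; congr pair; rewrite ?addr0 ?add0r.
apply: Ck_add => //; apply: Ck_clin_comp => //.
  exact: (clin_pair clin_id clin_cst0).
exact: (clin_pair clin_cst0 clin_id).
Qed.

Lemma clin_inl {V W} : clin (fun v : V => (v, 0 : W)).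
Proof. exact: (clin_pair clin_id clin_cst0). Qed.

Lemma continuous_atP {V W} (f : V -> W) (p : V) :
  (forall e : R, 0 < e -> \forall q \near p, `|f p - f q| < e) ->
  {for p, continuous f}.
Proof. by move=> H; apply/cvgrPdist_lt. Qed.

(** The estimate behind the differentiability of an implicit function: h is the
    length of the increment of the parameter, k the error of the linear
    approximation, x the size of that approximation, and a the partial
    derivative of the equation.  The error occurs on both sides, and the
    factor 1/2 allows it to be absorbed on the left. *)
Lemma implicit_increment (a e C h k x : R) : 0 < a -> 0 < e -> 0 < C -> 0 <= h ->
  x <= C * h ->
  a * `|k| <= a * Num.min 2^-1 (e / (2 * (1 + C))) * (h + (`|k| + x)) ->
  `|k| <= e * h.
Proof.
move=> a0 e0 C0 h0 xC; rewrite -mulrA ler_pM2l //.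
set m := Num.min _ _ => H.
have m1 : m <= 2^-1 by rewrite /m ge_min lexx.
have m2 : m <= e / (2 * (1 + C)) by rewrite /m ge_min lexx orbT.
have m0 : 0 <= m.
  by rewrite /m le_min invr_ge0 ler0n divr_ge0 // ?ltW // mulr_gt0 // addr_gt0.
have k0 : 0 <= `|k| by [].
have H1 : `|k| <= m * (h + C * h) + 2^-1 * `|k|.
  apply: (le_trans H).
  rewrite (_ : h + (`|k| + x) = (h + x) + `|k|); last by ring.
  rewrite mulrDr; apply: lerD; last exact: ler_wpM2r.
  by apply: ler_wpM2l => //; rewrite lerD2l.
have H2 : m * (h + C * h) <= 2^-1 * (e * h).
  apply: (@le_trans _ _ (e / (2 * (1 + C)) * (h + C * h))).
    by apply: ler_wpM2r => //; rewrite addr_ge0 // mulr_ge0 // ltW.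
  have C1 : 1 + C != 0 by rewrite lt0r_neq0 // addr_gt0.
  rewrite le_eqVlt; apply/orP; left; apply/eqP; field; exact: C1.
lra.
Qed.

(** Where the derivative of Phi along the factor R is positive, Phi(p, _) is
    increasing: it has one zero w(p) by the intermediate value theorem, and the
    signs of Phi on both sides of the zero make w continuous.  The expansion of
    Phi at (p, w(p)) makes w differentiable with
    'D_v w p = - 'D_(v, 0) Phi (p, w p) / 'D_(0, 1) Phi (p, w p),
    and this formula gives w one more derivative than it is known to have. *)
Lemma implicit_function_pos (Phi : plane R * R -> R) :
  smooth_germ Phi -> Phi 0 = 0 -> 0 < 'D_(0, 1) Phi 0 ->
  exists w : plane R -> R, [/\ smooth_germ w, w 0 = 0,
    \forall p \near (0 : plane R), Phi (p, w p) = 0 &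
    \forall z \near (0 : plane R * R), Phi z = 0 -> z.2 = w z.1].
Proof.
move=> [U oU CU] Phi0 DPhi0.
pose e2 : plane R * R := (0, 1).
pose D z := 'D_e2 Phi z.
have [_ /(_ e2) /(_ 0)] := CU 1%N; move/(_ oU.2) => cD.
have [r r0 Hr] : exists2 r : R, 0 < r &
    forall z : plane R * R, `|z| < r -> U z /\ 0 < D z.
  have hU : \forall z \near (0 : plane R * R), U z by exact: open_nbhs_nbhs.
  have hD : \forall z \near (0 : plane R * R), 0 < D z by exact: (cvgr_gt _ cD).
  have /near_normP[r r0 H] : \forall z \near (0 : plane R * R), U z /\ 0 < D z.
    by apply: filterS2 hU hD.
  by exists r => // z zr; apply: H; rewrite subr0.
have dPhi z : `|z| < r -> differentiable Phi z.
  by move=> /Hr[Uz _]; have [+ _] := CU 1%N; apply.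
have E (p : plane R) (s t : R) : (p, s) + t *: e2 = (p, s + t).
  rewrite /e2; congr pair => /=; first by rewrite scaler0 addr0.
  by congr (_ + _); rewrite -[LHS]/(t * 1) mulr1.
have mono p s s' : `|p| < r -> `|s| < r -> `|s'| < r -> s < s' ->
    Phi (p, s) < Phi (p, s').
  move=> pr sr sr' ss'.
  have B (x : R) : 0 <= x <= s' - s -> `|(p, s + x)| < r.
    move=> /andP[x0 xs]; rewrite prod_norm_lt pr /=.
    move: sr sr'; rewrite !ltr_norml => /andP[h1 h2] /andP[h3 h4]; lra.
  have ss0 : 0 <= s' - s by rewrite subr_ge0 ltW.
  have [x|x xs] := @MVT_ray _ _ Phi (p, s) e2 (s' - s) ss0.
    by move=> /B ?; rewrite E; exact: dPhi.
  rewrite !E (addrC s) subrK => Ex; rewrite -subr_gt0 Ex.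
  by rewrite mulr_gt0 ?subr_gt0 //; have [] := Hr _ (B x xs).
(* eps is half of r so that the zeros found in [- eps, eps] keep a margin
   inside the ball where Phi is increasing. *)
pose eps := r / 2.
have eps0 : 0 < eps by rewrite divr_gt0.
have epsr : eps < r by rewrite /eps; lra.
have n00 : `|0 : plane R| < r by rewrite normr0.
have n0r : `|0 : R| < r by rewrite normr0.
have neps : `|eps| < r by rewrite gtr0_norm.
have nNeps : `|- eps| < r by rewrite normrN.
have P1 : 0 < Phi (0, eps) by rewrite -Phi0; apply: mono.
have P2 : Phi (0, - eps) < 0 by rewrite -Phi0; apply: mono => //; rewrite oppr_lt0.
have cPhi (p : plane R) (s : R) : `|p| < r -> `|s| < r ->
    {for p, continuous (fun q => Phi (q, s))}.
  move=> pr sr; apply: differentiable_continuous.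
  apply: (@differentiable_comp _ _ _ _ (fun q => (q, s)) Phi) => //.
  by apply: dPhi; rewrite prod_norm_lt pr.
have [d /andP[d0 dr] Hd] : exists2 d : R, 0 < d <= r & forall p : plane R, `|p| < d ->
    Phi (p, - eps) < 0 < Phi (p, eps).
  have h1 : \forall p \near (0 : plane R), 0 < Phi (p, eps).
    exact: (cvgr_gt _ (cPhi _ _ n00 neps)).
  have h2 : \forall p \near (0 : plane R), Phi (p, - eps) < 0.
    exact: (cvgr_lt _ (cPhi _ _ n00 nNeps)).
  have /near_normP[d d0 H] : \forall p \near (0 : plane R), Phi (p, - eps) < 0 < Phi (p, eps).
    by apply: filterS2 h1 h2 => p a b; apply/andP.
  exists (Num.min d r); first by rewrite lt_min d0 r0 ge_min lexx orbT.
  by move=> p; rewrite lt_min => /andP[pd _]; apply: H; rewrite subr0.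
pose w (p : plane R) : R := xget 0 [set s : R | `|s| <= eps /\ Phi (p, s) = 0].
have wP p : `|p| < d -> `|w p| <= eps /\ Phi (p, w p) = 0.
  move=> pd; rewrite /w; case: xgetP => [s _ //|no].
  have pr := lt_le_trans pd dr.
  have /andP[h1 h2] := Hd _ pd.
  have cs : {within `[- eps, eps], continuous (fun s => Phi (p, s))}.
    apply: continuous_in_subspaceT => s; rewrite inE /= in_itv /= => /andP[s1 s2].
    apply: differentiable_continuous.
    apply: (@differentiable_comp _ _ _ _ (fun s => (p, s)) Phi) => //.
    apply: dPhi; rewrite prod_norm_lt pr /= (le_lt_trans _ epsr) //.
    by rewrite ler_norml s1.
  have e12 : - eps <= eps by lra.
  have [|s] := IVT e12 cs (v := 0).
    by rewrite ge_min (ltW h1) le_max (ltW h2) orbT.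
  rewrite in_itv /= => s12 Ps; case: (no s).
  by split=> //; rewrite ler_norml.
have wr p : `|p| < d -> `|w p| < r by move=> /wP[h _]; exact: le_lt_trans epsr.
have uniq p s : `|p| < d -> `|s| < r -> Phi (p, s) = 0 -> s = w p.
  move=> pd sr Ps; have pr := lt_le_trans pd dr.
  have [_ Pw] := wP p pd; have wpr := wr p pd.
  case: (ltgtP s (w p)) => // h.
    by have := mono _ _ _ pr sr wpr h; rewrite Ps Pw ltxx.
  by have := mono _ _ _ pr wpr sr h; rewrite Ps Pw ltxx.
have w0 : w 0 = 0 by apply/esym/uniq => //; rewrite normr0.
pose B := [set p : plane R | `|p| < d].
have oB : open B.
  rewrite openE => p /= pd; suff : \forall q \near p, B q by [].
  apply/near_normP; exists (d - `|p|); first by rewrite subr_gt0.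
  move=> q qp; rewrite /B /= -(subrK p q) (le_lt_trans (ler_normD _ _)) //.
  by rewrite -ltrBrDr.
have cw p : B p -> {for p, continuous w}.
  move=> Bp; apply: continuous_atP => n n0.
  have [wpe Pw] := wP p Bp; have pr := lt_le_trans Bp dr.
  pose m := Num.min n (r / 2) / 2.
  have rh : 0 < r / 2 by rewrite divr_gt0.
  have mm0 : 0 < Num.min n (r / 2) by rewrite lt_min n0 rh.
  have m0 : 0 < m by rewrite divr_gt0.
  have mn : m < n.
    rewrite /m; have : Num.min n (r / 2) <= n by rewrite ge_min lexx.
    move: mm0; set mm := Num.min _ _; lra.
  have mr : m < r / 2.
    rewrite /m; have : Num.min n (r / 2) <= r / 2 by rewrite ge_min lexx orbT.
    move: mm0; set mm := Num.min _ _; lra.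
  have [wl wu] : - eps <= w p /\ w p <= eps by apply/andP; rewrite -ler_norml.
  have r1 : `|w p + m| < r by rewrite ltr_norml; move: wl wu mr; rewrite /eps => *; lra.
  have r2 : `|w p - m| < r by rewrite ltr_norml; move: wl wu mr; rewrite /eps => *; lra.
  have h1 : \forall q \near p, 0 < Phi (q, w p + m).
    apply: (cvgr_gt _ (cPhi _ _ pr r1)); rewrite -Pw; apply: mono => //; [exact: wr|lra].
  have h2 : \forall q \near p, Phi (q, w p - m) < 0.
    apply: (cvgr_lt _ (cPhi _ _ pr r2)); rewrite -Pw; apply: mono => //; [exact: wr|lra].
  have h3 : \forall q \near p, B q by exact: open_nbhs_nbhs.
  apply: filterS3 h1 h2 h3 => q h1 h2 Bq.
  have [_ Pq] := wP q Bq; have qr := lt_le_trans Bq dr; have wqr := wr q Bq.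
  rewrite distrC ltr_norml; apply/andP; split.
    rewrite ltNge; apply/negP => h; suff : Phi (q, w q) < 0 by rewrite Pq ltxx.
    apply: lt_trans h2; apply: mono => //; lra.
  rewrite ltNge; apply/negP => h; suff : 0 < Phi (q, w q) by rewrite Pq ltxx.
  apply: lt_trans h1 _; apply: mono => //; lra.
have dw p : B p -> is_diff p w (fun v => - (D (p, w p))^-1 * 'd Phi (p, w p) (v, 0)).
  move=> Bp; have pr := lt_le_trans Bp dr; have [_ Pw] := wP p Bp.
  have zr : `|(p, w p)| < r by rewrite prod_norm_lt pr wr.
  have dz := dPhi _ zr; have [_ a0] := Hr _ zr; set a := D _ in a0 *.
  set L := fun v => _; have cL : clin L.
    apply: (clin_comp (clin_comp clin_inl (clin_diff dz)) (clin_mul _)).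
  have [C C0 HC] := clin_bound cL.
  apply: is_diff_clin => // e e0.
  (* This precision for Phi is the one that [implicit_increment] turns into
     the precision e for w. *)
  pose e' := a * Num.min 2^-1 (e / (2 * (1 + C))).
  have e'0 : 0 < e'.
    by rewrite mulr_gt0 // lt_min invr_gt0 ltr0n /= divr_gt0 // mulr_gt0 // addr_gt0.
  have hz := diff_epsP dz e'0.
  have h1 : \forall q \near p,
      `|Phi (q, w q) - Phi (p, w p) - 'd Phi (p, w p) ((q, w q) - (p, w p))|
      <= e' * `|(q, w q) - (p, w p)|.
    have [rho rho0 Hrho] := (near_normP _ _).1 hz.
    have n1 : \forall q \near p, `|q - p| < rho by apply/near_normP; exists rho.
    have n2 : \forall q \near p, `|w p - w q| < rho.
      by have /cvgrPdist_lt/(_ rho rho0) := cw p Bp.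
    apply: filterS2 n1 n2 => q n1 n2; apply: Hrho.
    by rewrite -[(q, w q) - _]/(q - p, w q - w p) prod_norm_lt n1 distrC.
  have h3 : \forall q \near p, B q by exact: open_nbhs_nbhs.
  apply: filterS2 h1 h3 => q h1 Bq; have [_ Pq] := wP q Bq.
  apply: (@implicit_increment a e C `|q - p| (w q - w p - L (q - p)) `|L (q - p)|) => //.
  move: h1; rewrite Pq Pw subrr sub0r normrN => h1.
  rewrite -[a in a * `|_|]gtr0_norm // -normrM.
  have -> : a * (w q - w p - L (q - p)) = 'd Phi (p, w p) ((q, w q) - (p, w p)).
    have -> : (q, w q) - (p, w p) = (q - p, 0) + (w q - w p) *: e2.
      rewrite /e2; congr pair => /=; first by rewrite scaler0 addr0.
      by rewrite add0r -[RHS]/(_ * 1) mulr1.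
    have da : 'd Phi (p, w p) e2 = a by rewrite -deriveE.
    have lz (x : R) : 'd Phi (p, w p) (x *: e2) = x * a.
      by rewrite linearZ -[LHS]/(x * 'd Phi (p, w p) e2) da.
    rewrite linearD lz /L -/a.
    set X := 'd Phi (p, w p) (q - p, 0); set Y := w q - w p.
    have an0 := lt0r_neq0 a0; clearbody X Y; clear -an0.
    by field; exact: an0.
  apply: le_trans h1 _; rewrite -/e'; apply: ler_wpM2l; first exact: ltW.
  apply: le_trans (prod_norm_le_sum _ _) _ => /=; apply: lerD => //.
  by rewrite -{1}(subrK (L (q - p)) (w q - w p)); exact: ler_normD.
have Dw v p : B p -> 'D_v w p = - (D (p, w p))^-1 * 'D_(v, 0) Phi (p, w p).
  move=> Bp; have [dwp ew] := dw p Bp; rewrite deriveE // ew deriveE //.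
  by apply: dPhi; rewrite prod_norm_lt wr // (lt_le_trans Bp).
pose Br := [set z : plane R * R | `|z| < r].
(* The formula Dw bootstraps the smoothness of w. *)
have Cw k : Ck k B w.
  elim: k => [|k IH] /=; first exact: cw.
  split=> [p Bp|v]; first by have [] := dw p Bp.
  have CP : Ck k B (fun p => (p, w p)).
    by apply: Ck_pair => //; apply: Ck_clin; exact: clin_id.
  have sB p : B p -> Br (p, w p).
    by move=> Bp; rewrite /Br /= prod_norm_lt wr // (lt_le_trans Bp).
  have C1 u : Ck k B (fun p => 'D_u Phi (p, w p)).
    have := CU k.+1 => -[_ /(_ u) Cu].
    apply: (@Ck_comp R _ _ _ _ _ k B Br (fun p => (p, w p)) (fun z => 'D_u Phi z)
      frame_plane_line oB sB CP).
    by apply: Ck_sub Cu => z /Hr[].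
  apply: (@Ck_eq _ _ _ k B (fun p => - (D (p, w p))^-1 * 'D_(v, 0) Phi (p, w p))) => //.
    by move=> q Bq; rewrite Dw.
  have nz p : B p -> D (p, w p) != 0 by move=> /sB /Hr[_]; exact: lt0r_neq0.
  exact: (Ck_mul oB (Ck_opp oB (Ck_inv oB nz (C1 e2))) (C1 (v, 0))).
exists w; split=> //.
- by exists B => //; split=> //; rewrite /B /= normr0.
- apply/near_normP; exists d => // p; rewrite subr0; exact: (fun h => (wP p h).2).
- apply/near_normP; exists d => // -[p s]; rewrite subr0 prod_norm_lt => /andP[pd sd] Pz.
  by apply: uniq => //; exact: lt_le_trans dr.
Qed.

Lemma implicit_function (Phi : plane R * R -> R) :
  smooth_germ Phi -> Phi 0 = 0 -> 'D_(0, 1) Phi 0 != 0 ->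
  exists w : plane R -> R, [/\ smooth_germ w, w 0 = 0,
    \forall p \near (0 : plane R), Phi (p, w p) = 0 &
    \forall z \near (0 : plane R * R), Phi z = 0 -> z.2 = w z.1].
Proof.
move=> sPhi Phi0; case: ltgtP => // [Dneg|Dpos] _; last exact: implicit_function_pos.
have [U oU CU] := sPhi.
have dPhi : differentiable Phi 0 by have [+ _] := CU 1%N; apply; exact: oU.2.
have sN : smooth_germ (fun z => - Phi z).
  by exists U => // k; apply: Ck_opp => //; exact: oU.1.
have [||w [sw w0 h1 h2]] := implicit_function_pos sN.
- by rewrite Phi0 oppr0.
- by rewrite (_ : (fun z => _) = - Phi) // deriveN ?oppr_gt0 //; exact: diff_derivable.
exists w; split=> //.
- by apply: filterS h1 => p /eqP; rewrite oppr_eq0 => /eqP.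
- by apply: filterS h2 => z h Pz; apply: h; rewrite Pz oppr0.
Qed.

End ImplicitFunction.

(** * Smooth division by powers of a coordinate *)

Section Division.
Context {R : realType}.
Implicit Types V W M : normedModType R.

Lemma MVT0 (f df : R -> R) (t : R) :
  (forall s : R, `|s| <= `|t| -> is_derive s 1 f (df s)) ->
  exists2 s : R, `|s| <= `|t| & f t - f 0 = t * df s.
Proof.
move=> H; have E (s : R) : 0 + s *: (1 : R) = s by rewrite add0r -[LHS]/(s * 1) mulr1.
have [s|s st] := @MVT_line R R f 0 1 t.
  by move=> /H [fd _]; rewrite E; apply/derivable1_diffP.
rewrite !E => Es; exists s => //; rewrite Es.
by have [_ ->] := H s st.
Qed.

Lemma is_derive_monomial n (c x : R) :
  is_derive x 1 (fun y : R => y ^+ n.+1 * c) (n.+1%:R * x ^+ n * c).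
Proof.
have -> : (fun y : R => y ^+ n.+1 * c) = horner (c *: 'X^(n.+1)).
  by apply/funext => y; rewrite !hornerE mulrC.
apply: is_derive_eq.
by rewrite derivZ derivXn hornerZ hornerMn hornerXn -mulr_natl mulrC.
Qed.

(** If a function phi 0 vanishes to order m at 0, then its quotient by s^m has
    at 0 the value and the derivative read off from the two derivatives of
    orders m and m + 1.  The proof integrates: the case m + 1 for phi follows
    from the case m for its derivative, by the mean value theorem. *)
Lemma taylor_two_terms (T C : R) m (phi : nat -> R -> R) :
  (forall j (s : R), `|s| <= T -> is_derive s 1 (phi j) (phi j.+1 s)) ->
  (forall j, (j < m)%N -> phi j 0 = 0) ->
  (forall s : R, `|s| <= T -> `|phi m.+2 s| <= C) ->
  forall s : R, `|s| <= T ->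
    `|phi 0%N s - s ^+ m * (phi m 0 / m`!%:R)
      - s ^+ m.+1 * (phi m.+1 0 / m.+1`!%:R)| <= C * `|s| ^+ m.+2.
Proof.
elim: m phi => [|m IH] phi dphi phi0 phiC s sT.
- rewrite expr0 expr1 fact0 !divr1 mul1r.
  have dpsi (x : R) : `|x| <= `|s| -> is_derive x 1 (fun s => phi 0%N s - s * phi 1%N 0)
      (phi 1%N x - phi 1%N 0).
    move=> xs; have D := dphi 0%N x (le_trans xs sT).
    apply: is_deriveB; apply: is_derive_eq.
    by rewrite /= scaler0 add0r -[LHS]/(_ * 1) mulr1.
  have [x xs Ex] := MVT0 dpsi.
  have [y yx Ey] : exists2 y : R, `|y| <= `|x| & phi 1%N x - phi 1%N 0 = x * phi 2%N y.
    by apply: MVT0 => y yx; apply: dphi; rewrite (le_trans yx) // (le_trans xs).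
  have -> : phi 0%N s - phi 0%N 0 - s * phi 1%N 0 = s * (x * phi 2%N y).
    by rewrite -Ey -Ex mul0r subr0 addrAC.
  have yT : `|y| <= T by rewrite (le_trans yx) // (le_trans xs).
  rewrite !normrM expr2 [leRHS]mulrCA; apply: ler_wpM2l => //.
  by rewrite [leRHS]mulrC; apply: ler_pM => //; exact: phiC.
set c0 := _ / _; set c1 := phi m.+2 0 / _.
pose psi x := phi 0%N x - x ^+ m.+1 * c0 - x ^+ m.+2 * c1.
pose dpsi (x : R) := phi 1%N x - x ^+ m * (phi m.+1 0 / m`!%:R)
                     - x ^+ m.+1 * (phi m.+2 0 / m.+1`!%:R).
have Hd (x : R) : `|x| <= `|s| -> is_derive x 1 psi (dpsi x).
  move=> xs; have D := dphi 0%N x (le_trans xs sT).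
  have H := is_deriveB (is_deriveB D (is_derive_monomial m c0 x))
                       (is_derive_monomial m.+1 c1 x).
  apply: (is_derive_eq H); rewrite /dpsi /c0 /c1 !factS !natrM.
  have n1 : m.+1%:R != 0 :> R by rewrite pnatr_eq0.
  have n2 : m.+2%:R != 0 :> R by rewrite pnatr_eq0.
  have n3 : m`!%:R != 0 :> R by rewrite pnatr_eq0 -lt0n fact_gt0.
  move: (x ^+ m) (x ^+ m.+1) n1 n2 n3 (phi m.+1 0) (phi m.+2 0) (phi 1%N x).
  move: (m.+1%:R) (m.+2%:R) (m`!%:R) => a b c u v n1 n2 n3 p1 p2 p3.
  by field; rewrite n1 n2 n3.
have [x xs Ex] := MVT0 Hd.
have := IH (fun j => phi j.+1) (fun j => dphi j.+1) (fun j => phi0 j.+1) phiC x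
  (le_trans xs sT).
rewrite -/(dpsi x) => Hx.
have p0 : psi 0 = 0 by rewrite /psi phi0 // !exprS !mul0r !subr0.
rewrite -/(psi s) -[psi s]subr0 -p0 Ex normrM [_ ^+ m.+3]exprS mulrCA.
apply: ler_wpM2l => //; apply: le_trans Hx _; apply: ler_wpM2l.
  by apply: le_trans (phiC 0 _) => //; rewrite normr0 (le_trans _ sT).
by apply: lerXn2r xs; rewrite nnegrE.
Qed.

Lemma plane_norm_lt (p : plane R) (r : R) : 0 < r ->
  (`|p| < r) = (`|p 0 0| < r) && (`|p 0 1| < r).
Proof.
move=> r0; apply/idP/andP => [pr|[h0 h1]].
  have H j : `|p 0 j| < r.
    apply: le_lt_trans pr; rewrite [leRHS]/Num.Def.normr /= mx_normrE.
    exact: (le_bigmax _ (fun ij => `|p ij.1 ij.2|) (0, j)).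
  by split.
rewrite [ltLHS]/Num.Def.normr /= mx_normrE; apply/bigmax_ltP; split=> // -[i j] _ /=.
rewrite ord1; case: j => [[|[|//]]] jp.
  by rewrite (_ : Ordinal jp = 0) //; exact: val_inj.
by rewrite (_ : Ordinal jp = 1) //; exact: val_inj.
Qed.

Lemma smooth_D {V W} (U : set V) (f : V -> W) v :
  smooth_on U f -> smooth_on U (fun p => 'D_v f p).
Proof. by move=> sf k; have [_] := sf k.+1; apply. Qed.

Lemma smooth_diff {V W} (U : set V) (f : V -> W) p :
  smooth_on U f -> U p -> differentiable f p.
Proof. by move=> sf Up; have [+ _] := sf 1%N; apply. Qed.

Definition d1 (g : plane R -> R) := fun p => 'D_(pt 1 0) g p.
Definition d2 (g : plane R -> R) := fun p => 'D_(pt 0 1) g p.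

Lemma derive_dir (g : plane R -> R) p v : differentiable g p ->
  'D_v g p = v 0 0 * d1 g p + v 0 1 * d2 g p.
Proof.
move=> dg; have := @derive_plane R _ (fun q => q) g p v (clin_differentiable p clin_id) dg.
rewrite -[g \o _]/g => ->.
by rewrite !(clin_derive _ _ (clin_coord _)).
Qed.

Lemma derive_coord_plane (p v : plane R) j : 'D_v (fun q : plane R => q 0 j) p = v 0 j.
Proof. exact: (clin_derive _ _ (clin_coord _)). Qed.

(** The projection to the axis p 0 1 = 0 along which functions are divided. *)
Definition foot (p : plane R) : plane R := pt (p 0 0) 0.

Lemma differentiable_foot p : differentiable foot p.
Proof.
apply: differentiable_pt; last exact: differentiable_cst.
exact: clin_differentiable (clin_coord 0).
Qed.

Lemma derive_foot (g : plane R -> R) p v : differentiable g (foot p) ->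
  'D_v (g \o foot) p = v 0 0 * d1 g (foot p).
Proof.
move=> dg; rewrite derive_plane //; last exact: differentiable_foot.
have -> : (fun q => foot q 0 0) = (fun q : plane R => q 0 0).
  by apply/funext => q; rewrite ptE.
have -> : (fun q => foot q 0 1) = (fun q : plane R => 0).
  by apply/funext => q; rewrite ptE.
by rewrite derive_coord_plane derive_cst mul0r addr0.
Qed.

Lemma open_ball_norm {V} (r : R) : open [set p : V | `|p| < r].
Proof.
rewrite openE => p /= pd; suff : \forall q \near p, [set p : V | `|p| < r] q by [].
apply/near_normP; exists (r - `|p|); first by rewrite subr_gt0.
move=> q qp /=; rewrite -(subrK p q) (le_lt_trans (ler_normD _ _)) //.
by rewrite -ltrBrDr.
Qed.

Section OnBall.
Variables (r : R) (r0 : 0 < r).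
Let B := [set p : plane R | `|p| < r].

Definition d2n j (g : plane R -> R) := iter j d2 g.

Let oB : open B := open_ball_norm r.

Lemma d2nS j g p : d2n j.+1 g p = 'D_(pt 0 1) (d2n j g) p.
Proof. by []. Qed.

Lemma smooth_d2n j g : smooth_on B g -> smooth_on B (d2n j g).
Proof. by move=> sg; elim: j => [//|j IH]; exact: smooth_D. Qed.

Let Bfoot p : B p -> B (foot p).
Proof.
by rewrite /B /= !plane_norm_lt // !ptE normr0 r0 andbT => /andP[].
Qed.

Definition vanishing m (g : plane R -> R) :=
  forall j (p : plane R), (j < m)%N -> B p -> p 0 1 = 0 -> d2n j g p = 0.

(** g / t^m where t = p 0 1, extended to the axis t = 0 by its limit. *)
Definition quot m g (p : plane R) : R :=
  if p 0 1 == 0 then d2n m g p / m`!%:R else g p / p 0 1 ^+ m.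

(** The derivative of g / t^m along t is (t g_t - m g) / t^(m+1).  This numerator
    vanishes to order m + 1 when g vanishes to order m, so that the quotients
    [quot m g] form a family closed under derivation. *)
Definition quot_numerator m (g : plane R -> R) (p : plane R) : R := p 0 1 * d2 g p - m%:R * g p.

Lemma d2n_d1 j g p : smooth_on B g -> B p -> d2n j (d1 g) p = d1 (d2n j g) p.
Proof.
move=> sg; elim: j p => [//|j IH] p Bp.
rewrite -[LHS]/(d2 (d2n j (d1 g)) p).
have -> : d2 (d2n j (d1 g)) p = d2 (d1 (d2n j g)) p.
  by apply: near_eq_derive; exact: eq_near_open IH.
exact: (derive_symmetric _ _ oB Bp (smooth_d2n j sg 2%N)).
Qed.

Lemma smooth_coord j : smooth_on B (fun p : plane R => p 0 j).
Proof. by move=> k; apply: Ck_clin; exact: clin_coord. Qed.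

Lemma smooth_quot_numerator m g : smooth_on B g -> smooth_on B (quot_numerator m g).
Proof.
move=> sg k.
have H1 := Ck_mul oB (smooth_coord 1 k) (smooth_D (pt 0 1) sg k).
have H2 := Ck_opp oB (Ck_mul oB (Ck_cst k B (m%:R : R)) (sg k)).
exact: (Ck_add oB H1 H2).
Qed.

Lemma d2n_quot_numerator j m g p : smooth_on B g -> B p ->
  d2n j (quot_numerator m g) p = p 0 1 * d2n j.+1 g p + (j%:R - m%:R) * d2n j g p.
Proof.
move=> sg; elim: j p => [|j IH] p Bp; first by rewrite sub0r mulNr.
rewrite -[LHS]/(d2 (d2n j (quot_numerator m g)) p).
have -> : d2 (d2n j (quot_numerator m g)) p =
    d2 (fun p => p 0 1 * d2n j.+1 g p + (j%:R - m%:R) * d2n j g p) p.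
  by apply: near_eq_derive; exact: eq_near_open IH.
have D1 := smooth_diff (smooth_d2n j.+1 sg) Bp.
have D0 := smooth_diff (smooth_d2n j sg) Bp.
have Dc : differentiable (fun q : plane R => q 0 1) p.
  exact: clin_differentiable (clin_coord 1).
rewrite /d2 [LHS]deriveD; last 2 first.
- by apply: derivableM; exact: diff_derivable.
- by apply: derivableM; [exact: derivable_cst|exact: diff_derivable].
rewrite [X in X + _]deriveM; try exact: diff_derivable.
rewrite [X in _ + X]deriveM; [|exact: derivable_cst|exact: diff_derivable].
rewrite derive_coord_plane ptE derive_cst scaler0 addr0.
rewrite -(d2nS j.+1) -(d2nS j) -natr1 -![_ *: _]/(_ * _).
move: (d2n j.+2 g p) (d2n j.+1 g p) (d2n j g p) (p 0 1) => x1 x2 x3 x4; ring.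
Qed.

Lemma vanishing_quot_numerator m g : smooth_on B g -> vanishing m g ->
  vanishing m.+1 (quot_numerator m g).
Proof.
move=> sg zg j p jm Bp p1; rewrite d2n_quot_numerator // p1 mul0r add0r.
move: jm; rewrite ltnS leq_eqVlt => /orP[/eqP ->|jm]; first by rewrite subrr mul0r.
by rewrite zg // mulr0.
Qed.

Lemma foot_id (p : plane R) : p 0 1 = 0 -> foot p = p.
Proof. by move=> p1; rewrite -[RHS]pt_eta p1. Qed.

Lemma vanishing_d1 m g : smooth_on B g -> vanishing m g -> vanishing m (d1 g).
Proof.
move=> sg zg j p jm Bp p1; rewrite d2n_d1 //.
have := @derive_foot (d2n j g) p (pt 1 0).
rewrite (foot_id p1) ptE mul1r => <-; last exact: smooth_diff (smooth_d2n j sg) Bp.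
rewrite (@near_eq_derive _ _ _ _ (fun=> 0)) ?derive_cst //.
apply: (@eq_near_open R _ _ B) => // q Bq /=.
by rewrite zg ?ptE //; exact: Bfoot.
Qed.

Lemma quot_taylor m g p : smooth_on B g -> vanishing m g -> B p -> p 0 1 = 0 ->
  exists C : R, 0 <= C /\ \forall q \near p,
    `|quot m g q - (d2n m g (foot q) / m`!%:R
        + q 0 1 * (d2n m.+1 g (foot q) / m.+1`!%:R))| <= C * `|q 0 1| ^+ 2.
Proof.
move=> sg zg Bp p1.
(* C bounds the remainder term of the Taylor expansion near p. *)
pose C := `|d2n m.+2 g p| + 1.
have C0 : 0 <= C by rewrite addr_ge0.
have c2 : {for p, continuous (d2n m.+2 g)}.
  exact: (Ck_continuous (smooth_d2n m.+2 sg 0%N)).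
have h1 : \forall q \near p, B q by exact: open_nbhs_nbhs.
have h2 : \forall q \near p, `|d2n m.+2 g p - d2n m.+2 g q| < 1.
  by have /cvgrPdist_lt/(_ 1 ltr01) := c2.
have /near_normP[d d0 Hd] : \forall q \near p, B q /\ `|d2n m.+2 g q| <= C.
  apply: filterS2 h1 h2 => q Bq hq; split=> //.
  rewrite -(subrK (d2n m.+2 g p) (d2n m.+2 g q)) (le_trans (ler_normD _ _)) // addrC.
  by rewrite lerD2l distrC ltW.
exists C; split=> //; apply/near_normP; exists d => // q qd.
have [q0 qt] : `|q 0 0 - p 0 0| < d /\ `|q 0 1| < d.
  move: qd; rewrite plane_norm_lt // => /andP[].
  by rewrite !mxE p1 subr0.
have E2 s : foot q + s *: pt 0 1 = pt (q 0 0) s.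
  by rewrite /foot ptZ ptD mulr0 mulr1 addr0 add0r.
have Hs (s : R) : `|s| <= `|q 0 1| ->
    B (foot q + s *: pt 0 1) /\ `|d2n m.+2 g (foot q + s *: pt 0 1)| <= C.
  move=> sq; apply: Hd; rewrite E2 plane_norm_lt // !mxE /= p1 subr0 q0 /=.
  exact: le_lt_trans qt.
pose phi j (s : R) := d2n j g (foot q + s *: pt 0 1).
have F0 : foot q + 0 *: pt 0 1 = foot q by rewrite scale0r addr0.
have Fq : foot q + q 0 1 *: pt 0 1 = q by rewrite E2 pt_eta.
have dphi j (s : R) : `|s| <= `|q 0 1| -> is_derive s 1 (phi j) (phi j.+1 s).
  move=> /Hs[Bs _]; apply: is_derive_line.
  exact: smooth_diff (smooth_d2n j sg) Bs.
have phi0 j : (j < m)%N -> phi j 0 = 0.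
  move=> jm; rewrite /phi F0; apply: zg => //; last by rewrite ptE.
  have n00 : `|0 : R| <= `|q 0 1| by rewrite normr0.
  by have [Bs _] := Hs 0 n00; rewrite F0 in Bs.
have phiC (s : R) : `|s| <= `|q 0 1| -> `|phi m.+2 s| <= C by move=> /Hs[].
have := taylor_two_terms dphi phi0 phiC (lexx _).
rewrite /phi F0 Fq /=.
set c0 := _ / _; set c1 := _ / m.+1`!%:R => H.
rewrite /quot; case: eqP => [q1|/eqP q1].
  have -> : d2n m g q / m`!%:R = c0 by rewrite /c0 (foot_id q1).
  by rewrite q1 mul0r addr0 subrr normr0 mulr_ge0.
have n1 : q 0 1 ^+ m != 0 by rewrite expf_neq0.
have -> : g q / q 0 1 ^+ m - (c0 + q 0 1 * c1)
    = (g q - q 0 1 ^+ m * c0 - q 0 1 ^+ m.+1 * c1) / q 0 1 ^+ m.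
  by rewrite exprS; field; exact: n1.
rewrite normrM normfV ler_pdivrMr ?normr_gt0 // normrX -mulrA -exprD.
by rewrite add2n; exact: H.
Qed.

(** On the axis, [quot_taylor] compares the quotient with A = c_m + t c_(m+1),
    where c_j is the Taylor coefficient of order j along t; A has the required
    derivative.  The derivative of c_m along the axis is the coefficient of
    order m of d1 g because mixed derivatives commute. *)
Lemma quot_derive0 m g p v : smooth_on B g -> vanishing m g -> B p -> p 0 1 = 0 ->
  differentiable (quot m g) p /\
  'D_v (quot m g) p = v 0 0 * quot m (d1 g) p + v 0 1 * quot m.+1 (quot_numerator m g) p.
Proof.
move=> sg zg Bp p1.
have [C [C0 HC]] := quot_taylor sg zg Bp p1.
pose c j (q : plane R) := (d2n j g \o foot) q * (j`!%:R)^-1.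
pose A (q : plane R) := c m q + q 0 1 * c m.+1 q.
have Fp := foot_id p1.
have dF : differentiable (d2n m g) (foot p).
  by rewrite Fp; exact: smooth_diff (smooth_d2n m sg) Bp.
have dj j : differentiable (d2n j g \o foot) p.
  apply: differentiable_comp; first exact: differentiable_foot.
  by rewrite Fp; exact: smooth_diff (smooth_d2n j sg) Bp.
have dcj j : differentiable (c j) p by apply: differentiableM.
have dco : differentiable (fun q : plane R => q 0 1) p.
  exact: clin_differentiable (clin_coord 1).
have dA : differentiable A p.
  by apply: differentiableD => //; apply: differentiableM.
have Dc : 'D_v (c m) p = v 0 0 * d1 (d2n m g) p / m`!%:R.
  rewrite [LHS]deriveM; [|exact: diff_derivable|exact: derivable_cst].
  rewrite derive_cst scaler0 add0r (derive_foot v dF) Fp.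
  by rewrite -[LHS]/(_ * (_ * _)) mulrC.
have DA : 'D_v A p = v 0 0 * (d1 (d2n m g) p / m`!%:R) + v 0 1 * (d2n m.+1 g p / m.+1`!%:R).
  rewrite [LHS]deriveD; last 2 first.
  - exact: diff_derivable.
  - by apply: diff_derivable; exact: differentiableM.
  rewrite Dc [X in _ + X]deriveM; try exact: diff_derivable.
  by rewrite derive_coord_plane p1 scale0r add0r /c /= Fp mulrA [_ *: _]mulrC.
have dq : is_diff p (quot m g) ('d A p).
  apply: is_diff_eps; first exact: diff_continuous.
  move=> e e0; have e2 : 0 < e / 2 by rewrite divr_gt0.
  have hA := diff_epsP dA e2.
  have hn : \forall q \near p, `|q - p| < e / (2 * (C + 1)).
    apply/near_normP; exists (e / (2 * (C + 1))) => //.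
    by rewrite divr_gt0 // mulr_gt0 // ltr_wpDl.
  apply: filterS3 HC hA hn => q HC hA hn.
  have Ap : A p = quot m g p.
    by rewrite /A /quot p1 eqxx mul0r addr0 /c /= Fp.
  have -> : quot m g q - quot m g p - 'd A p (q - p)
      = (A q - A p - 'd A p (q - p)) + (quot m g q - A q).
    rewrite Ap; move: (quot m g q) (quot m g p) ('d A p (q - p)) (A q) => x1 x2 x3 x4; ring.
  apply: le_trans (ler_normD _ _) _; rewrite [e]splitr mulrDl; apply: lerD => //.
  apply: le_trans HC _.
  have qp : `|q 0 1| <= `|q - p|.
    rewrite [leRHS]/Num.Def.normr /= mx_normrE.
    apply: le_trans (le_bigmax _ (fun ij => `|(q - p) ij.1 ij.2|) (0, 1)).
    by rewrite /= !mxE p1 subr0.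
  apply: (@le_trans _ _ (C * `|q - p| * `|q - p|)).
    by rewrite -mulrA -expr2; apply: ler_wpM2l => //; apply: lerXn2r => //; rewrite nnegrE.
  apply: ler_wpM2r => //.
  apply: (@le_trans _ _ ((C + 1) * `|q - p|)); first by apply: ler_wpM2r => //; rewrite lerDl.
  apply: (@le_trans _ _ ((C + 1) * (e / (2 * (C + 1))))).
    by apply: ler_wpM2l; [rewrite addr_ge0|exact: ltW].
  have C1 : C + 1 != 0 by rewrite lt0r_neq0 // ltr_wpDl.
  by rewrite le_eqVlt; apply/orP; left; apply/eqP; field; exact: C1.
case: dq => dq eq; split=> //.
rewrite deriveE // eq -deriveE // DA; congr (_ * _ + _ * _).
  by rewrite /quot p1 eqxx d2n_d1.
rewrite /quot p1 eqxx d2n_quot_numerator // p1 mul0r add0r -natr1 addrAC subrr add0r mul1r //.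
Qed.

Lemma quot_derive1 m g p v : smooth_on B g -> B p -> p 0 1 != 0 ->
  differentiable (quot m g) p /\
  'D_v (quot m g) p = v 0 0 * quot m (d1 g) p + v 0 1 * quot m.+1 (quot_numerator m g) p.
Proof.
move=> sg Bp p1.
have dco : differentiable (fun q : plane R => q 0 1) p.
  exact: clin_differentiable (clin_coord 1).
have nz : \forall q \near p, (q : plane R) 0 1 != 0.
  exact: cvgr_neq0 (differentiable_continuous dco) p1.
have E : \forall q \near p, (g * (fun q : plane R => (q 0 1 ^+ m)^-1)) q = quot m g q.
  by apply: filterS nz => q q1; rewrite /quot (negbTE q1).
have dg := smooth_diff sg Bp.
have eX : (fun q : plane R => q 0 1 ^+ m) = (fun q : plane R => q 0 1) ^+ m.
  by apply/funext => q; rewrite exprfctE.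
have dX : differentiable (fun q : plane R => q 0 1 ^+ m) p.
  rewrite eX; case: (m) => [|n]; last exact: differentiableX.
  by rewrite expr0; exact: differentiable_cst.
have nX : p 0 1 ^+ m != 0 by rewrite expf_neq0.
have dV : differentiable (fun q : plane R => (q 0 1 ^+ m)^-1) p by exact: differentiableV.
split; first by apply: near_differentiable E _; exact: differentiableM.
rewrite -(near_eq_derive v E) deriveM; try exact: diff_derivable.
rewrite deriveV //; last exact: diff_derivable.
rewrite eX deriveX; last exact: diff_derivable.
rewrite derive_coord_plane (derive_dir v dg).
rewrite /quot (negbTE p1) /quot_numerator.
case: m nX {E dX dV eX} => [|m] nX.
  by rewrite /= -![_ *: _]/(_ * _) !expr0 expr1; field; exact: p1.
rewrite /= [p 0 1 ^+ m.+2]exprS [p 0 1 ^+ m.+1]exprS.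
have nm : p 0 1 ^+ m != 0 by rewrite expf_neq0.
rewrite -![_ *: _]/(_ * _).
move: (p 0 1) (p 0 1 ^+ m) p1 nm (m.+1%:R) (d1 g p) (d2 g p) (g p) (v 0 0) (v 0 1).
by move=> t T t0 T0 n a b x v0 v1; field; rewrite t0 T0.
Qed.

Lemma quot_derive m g p v : smooth_on B g -> vanishing m g -> B p ->
  differentiable (quot m g) p /\
  'D_v (quot m g) p = v 0 0 * quot m (d1 g) p + v 0 1 * quot m.+1 (quot_numerator m g) p.
Proof.
move=> sg zg Bp; have [p1|p1] := eqVneq (p 0 1) 0.
  exact: quot_derive0.
exact: quot_derive1.
Qed.

(** By [quot_derive] the derivatives of a quotient are quotients of the same
    kind, so a single order of differentiability for all of them gives every
    order. *)
Lemma smooth_quot m g : smooth_on B g -> vanishing m g -> smooth_on B (quot m g).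
Proof.
move=> sg zg k; elim: k m g sg zg => [|k IH] m g sg zg.
  by move=> p Bp; apply: differentiable_continuous; have [] := quot_derive 0 sg zg Bp.
split=> [p Bp|v]; first by have [] := quot_derive 0 sg zg Bp.
have H1 := IH m (d1 g) (smooth_D _ sg) (vanishing_d1 sg zg).
have H2 := IH m.+1 (quot_numerator m g) (smooth_quot_numerator m sg)
  (vanishing_quot_numerator sg zg).
apply: (@Ck_eq _ _ _ k B (fun p => v 0 0 * quot m (d1 g) p
                                  + v 0 1 * quot m.+1 (quot_numerator m g) p)) => //.
  by move=> q Bq; have [_ ->] := quot_derive v sg zg Bq.
exact: (Ck_add oB (Ck_mul oB (Ck_cst k B (v 0 0)) H1) (Ck_mul oB (Ck_cst k B (v 0 1)) H2)).
Qed.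

Lemma quotE m g p : vanishing m g -> B p -> g p = p 0 1 ^+ m * quot m g p.
Proof.
move=> zg Bp; rewrite /quot; case: eqP => [p1|/eqP p1]; last first.
  by rewrite mulrC divfK // expf_neq0.
case: m zg => [|m] zg; first by rewrite expr0 mul1r fact0 divr1.
by rewrite p1 exprS !mul0r -[g p]/(d2n 0 g p) zg.
Qed.

End OnBall.

(** Smooth division by t^m, where t = p 0 1.  It is proved by differentiating
    quotients instead of integrating g under the integral sign. *)
Lemma hadamard m (g : plane R -> R) : smooth_germ g ->
  (\forall p \near (0 : plane R), (p : plane R) 0 1 = 0 -> forall j, (j < m)%N -> d2n j g p = 0) ->
  exists2 h : plane R -> R, smooth_germ h &
    \forall p \near (0 : plane R), g p = (p : plane R) 0 1 ^+ m * h p.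
Proof.
move=> [U oU sg] zg; have hU : \forall p \near (0 : plane R), U p by exact: open_nbhs_nbhs.
have /near_normP[r r0 Hr] : \forall p \near (0 : plane R), U p /\
    ((p : plane R) 0 1 = 0 -> forall j, (j < m)%N -> d2n j g p = 0).
  by apply: filterS2 hU zg => p.
pose B := [set p : plane R | `|p| < r].
have HB p : B p -> U p /\ (p 0 1 = 0 -> forall j, (j < m)%N -> d2n j g p = 0).
  by move=> pr; apply: Hr; rewrite subr0.
have sgB : smooth_on B g by move=> k; apply: Ck_sub (sg k) => p /HB[].
have zgB : vanishing r m g.
  by move=> j p jm pr p1; have [_ H] := HB p pr; exact: H.
have oB : open_nbhs (0 : plane R) B.
  split; last by rewrite /B /= normr0.
  exact: open_ball_norm.
exists (quot m g); first by exists B => //; exact: smooth_quot.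
by apply/near_normP; exists r => // p; rewrite subr0 => pr; exact: (quotE zgB).
Qed.

End Division.

(** * Germs of smooth maps and A-equivalence *)

Section Germs.
Context {R : realType}.
Implicit Types V W M : normedModType R.

Lemma smooth_on_sub {V W} (U U' : set V) (f : V -> W) :
  U' `<=` U -> smooth_on U f -> smooth_on U' f.
Proof. by move=> sU sf k; exact: Ck_sub (sf k). Qed.

Lemma near_open {V} (P : V -> Prop) : (\forall p \near (0 : V), P p) ->
  exists2 U : set V, open_nbhs 0 U & forall p, U p -> P p.
Proof.
move=> /near_normP[r r0 Hr]; exists [set p : V | `|p| < r].
  by split; [exact: open_ball_norm|rewrite /= normr0].
by move=> p pr; apply: Hr; rewrite subr0.
Qed.

Lemma germ_near {V W} (f : V -> W) : smooth_germ f ->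
  \forall p \near (0 : V), differentiable f p.
Proof.
move=> [U oU sf]; apply: filterS (open_nbhs_nbhs oU) => p Up.
exact: smooth_diff sf Up.
Qed.

Lemma germ_diff {V W} (f : V -> W) : smooth_germ f -> differentiable f 0.
Proof. by move=> /germ_near/nbhs_singleton. Qed.

Lemma germ_cont {V W} (f : V -> W) : smooth_germ f -> {for 0, continuous f}.
Proof. by move=> /germ_diff/differentiable_continuous. Qed.

Lemma germ_two {V W W'} (f : V -> W) (g : V -> W') :
  smooth_germ f -> smooth_germ g ->
  exists U : set V, [/\ open_nbhs 0 U, smooth_on U f & smooth_on U g].
Proof.
move=> [U oU sf] [U' oU' sg]; exists (U `&` U'); split.
- exact: open_nbhsI.
- by apply: smooth_on_sub sf => p [].
- by apply: smooth_on_sub sg => p [].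
Qed.

Lemma germ_clin {V W} (l : V -> W) : clin l -> smooth_germ l.
Proof.
move=> cl; exists setT; first exact: open_nbhsT.
by move=> k; exact: Ck_clin.
Qed.

Lemma germ_cst {V W} (c : W) : smooth_germ (fun _ : V => c).
Proof. by exists setT; [exact: open_nbhsT|move=> k; exact: Ck_cst]. Qed.

Lemma germ_add {V W} (f g : V -> W) : smooth_germ f -> smooth_germ g ->
  smooth_germ (fun p => f p + g p).
Proof.
move=> sf sg; have [U [oU hf hg]] := germ_two sf sg; exists U => // k.
exact: (Ck_add oU.1 (hf k) (hg k)).
Qed.

Lemma germ_opp {V W} (f : V -> W) : smooth_germ f -> smooth_germ (fun p => - f p).
Proof. by move=> [U oU sf]; exists U => // k; exact: (Ck_opp oU.1 (sf k)). Qed.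

Lemma germ_mul {V} (f g : V -> R) : smooth_germ f -> smooth_germ g ->
  smooth_germ (fun p => f p * g p).
Proof.
move=> sf sg; have [U [oU hf hg]] := germ_two sf sg; exists U => // k.
exact: (Ck_mul oU.1 (hf k) (hg k)).
Qed.

Lemma germ_exp {V} (f : V -> R) n : smooth_germ f -> smooth_germ (fun p => f p ^+ n).
Proof.
move=> sf; elim: n => [|n IH].
  have -> : (fun p => f p ^+ 0) = fun=> 1 by apply/funext => p; rewrite expr0.
  exact: germ_cst.
have -> : (fun p => f p ^+ n.+1) = fun p => f p * f p ^+ n.
  by apply/funext => p; rewrite exprS.
exact: germ_mul.
Qed.

Lemma germ_coord (j : 'I_2) : smooth_germ (fun p : plane R => p 0 j).
Proof. exact: germ_clin (clin_coord j). Qed.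

Lemma germ_D {V W} (f : V -> W) v : smooth_germ f -> smooth_germ (fun p => 'D_v f p).
Proof. by move=> [U oU sf]; exists U => //; exact: smooth_D. Qed.

Lemma germ_near_neq0 {V} (f : V -> R) : smooth_germ f -> f 0 != 0 ->
  \forall p \near (0 : V), f p != 0.
Proof. by move=> sf f0; exact: cvgr_neq0 (germ_cont sf) f0. Qed.

Lemma germ_inv {V} (f : V -> R) : smooth_germ f -> f 0 != 0 ->
  smooth_germ (fun p => (f p)^-1).
Proof.
move=> sf f0; have [U oU hf] := sf.
have [U' oU' nz] := near_open (germ_near_neq0 sf f0).
exists (U `&` U'); first exact: open_nbhsI.
move=> k; have oI : open (U `&` U') by exact: openI oU.1 oU'.1.
apply: (Ck_inv oI); first by move=> p [_ /nz].
by apply: Ck_sub (hf k) => p [].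
Qed.

Lemma germ_eq {V W} (f g : V -> W) : (\forall p \near (0 : V), f p = g p) ->
  smooth_germ f -> smooth_germ g.
Proof.
move=> /near_open[U' oU' fg] [U oU hf].
exists (U `&` U'); first exact: open_nbhsI.
move=> k; have oI : open (U `&` U') by exact: openI oU.1 oU'.1.
apply: (Ck_eq oI (f := f)); first by move=> p [_ /fg].
by apply: Ck_sub (hf k) => p [].
Qed.

(** The preimage under f of a neighbourhood of 0 is open only inside the domain
    on which f is continuous. *)
Lemma germ_comp_on {V M} (f : V -> M) : smooth_germ f -> f 0 = 0 ->
  forall U', open_nbhs (0 : M) U' ->
  exists U : set V, [/\ open_nbhs 0 U, smooth_on U f & forall p, U p -> U' (f p)].
Proof.
move=> [U oU hf] f0 U' oU'.
exists (U `&` (f @^-1` U')); split.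
- split; last by split; [exact: oU.2|rewrite /= f0; exact: oU'.2].
  rewrite openE => p [Up Ufp].
  have cf : {for p, continuous f} by exact: Ck_continuous (hf 0%N) Up.
  apply: filterI; first exact: open_nbhs_nbhs (conj oU.1 Up).
  exact: cf (open_nbhs_nbhs (conj oU'.1 Ufp)).
- by apply: smooth_on_sub hf => p [].
- by move=> p [].
Qed.

Lemma germ_comp_frame {V M} n (e : 'I_n -> M) l (f : V -> M) (g : M -> R) :
  frame e l -> smooth_germ f -> f 0 = 0 -> smooth_germ g ->
  smooth_germ (fun p => g (f p)).
Proof.
move=> fr sf f0 [U' oU' hg].
have [U [oU hf sU]] := germ_comp_on sf f0 oU'.
exists U => // k.
exact: (@Ck_comp R _ _ _ _ _ k U U' f g fr oU.1 sU (hf k) (hg k)).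
Qed.

Lemma germ_comp {V} (f : V -> plane R) (g : plane R -> R) :
  smooth_germ f -> f 0 = 0 -> smooth_germ g -> smooth_germ (fun p => g (f p)).
Proof. exact: germ_comp_frame frame_plane. Qed.

Lemma germ_pt {V} (a b : V -> R) : smooth_germ a -> smooth_germ b ->
  smooth_germ (fun p => pt (a p) (b p)).
Proof.
move=> sa sb; have [U [oU ha hb]] := germ_two sa sb; exists U => // k.
exact: (Ck_pt oU.1 (ha k) (hb k)).
Qed.

Lemma germ_coordf {V} (f : V -> plane R) j : smooth_germ f ->
  smooth_germ (fun p => f p 0 j).
Proof. by move=> [U oU sf]; exists U => // k; exact: (Ck_coord j oU.1 (sf k)). Qed.

Lemma near_comp {V M} (f : V -> M) (P : M -> Prop) : smooth_germ f -> f 0 = 0 ->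
  (\forall q \near (0 : M), P q) -> \forall p \near (0 : V), P (f p).
Proof.
move=> sf f0 HP; apply: (germ_cont sf); rewrite f0; exact: HP.
Qed.

Lemma germ_comp_plane {V} (f : V -> plane R) (g : plane R -> plane R) :
  smooth_germ f -> f 0 = 0 -> smooth_germ g -> smooth_germ (fun p => g (f p)).
Proof.
move=> sf f0 sg.
have -> : (fun p => g (f p)) = fun p => pt (g (f p) 0 0) (g (f p) 0 1).
  by apply/funext => p; rewrite pt_eta.
by apply: germ_pt; apply: (germ_comp sf f0 (germ_coordf _ sg)).
Qed.

Lemma map_germ_comp (f g : plane R -> plane R) :
  map_germ f -> map_germ g -> map_germ (g \o f).
Proof.
by move=> [sf f0] [sg g0]; split; [exact: germ_comp_plane|rewrite /= f0].
Qed.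

Lemma map_germ_pt (a b : plane R -> R) : smooth_germ a -> smooth_germ b ->
  a 0 = 0 -> b 0 = 0 -> map_germ (fun p => pt (a p) (b p)).
Proof. by move=> sa sb a0 b0; split; [exact: germ_pt|rewrite a0 b0 pt00]. Qed.

Lemma diffeo_sym (f g : plane R -> plane R) :
  inverse_diffeo_germs f g -> inverse_diffeo_germs g f.
Proof. by case. Qed.

Lemma diffeo_comp (f f' g g' : plane R -> plane R) :
  inverse_diffeo_germs f f' -> inverse_diffeo_germs g g' ->
  inverse_diffeo_germs (g \o f) (f' \o g').
Proof.
move=> [mf mf' e1 e2] [mg mg' e3 e4]; split; try exact: map_germ_comp.
- apply: filterS2 e1 (near_comp mf.1 mf.2 e3) => p h1 h3 /=.
  by rewrite h3 h1.
- apply: filterS2 e4 (near_comp mg'.1 mg'.2 e2) => p h1 h3 /=.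
  by rewrite h3 h1.
Qed.

Lemma A_equivalent_sym (f g : plane R -> plane R) : map_germ f ->
  A_equivalent f g -> A_equivalent g f.
Proof.
move=> mf [phi [phi' [psi [psi' [dphi dpsi e]]]]].
exists phi', phi, psi', psi; split; try exact: diffeo_sym.
have [mphi _ e1 _] := dphi; have [_ _ e2 _] := dpsi.
apply: filterS3 (near_comp mphi.1 mphi.2 e) e1 (near_comp mf.1 mf.2 e2) => p -> -> ->.
by [].
Qed.

Lemma A_equivalent_trans (f g h : plane R -> plane R) :
  A_equivalent f g -> A_equivalent g h -> A_equivalent f h.
Proof.
move=> [phi [phi' [psi [psi' [dphi dpsi e]]]]] [a [a' [b [b' [da db e']]]]].
exists (a \o phi), (phi' \o a'), (b \o psi), (psi' \o b'); split.
- exact: diffeo_comp.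
- exact: diffeo_comp.
- have [_ ma' _ _] := da.
  by apply: filterS2 e' (near_comp ma'.1 ma'.2 e) => p -> ->.
Qed.

Lemma diffeo_intro (f g : plane R -> plane R) : map_germ f -> map_germ g ->
  cancel f g -> cancel g f -> inverse_diffeo_germs f g.
Proof. by move=> mf mg fg gf; split=> //; apply: filterE => p; [exact: fg|exact: gf]. Qed.

Lemma diffeo_id : inverse_diffeo_germs (@id (plane R)) id.
Proof. by apply: diffeo_intro => //; split=> //; exact: germ_clin clin_id. Qed.

End Germs.

(** * Triangular diffeomorphisms and Jacobian determinants *)

Section Derivations.
Context {R : realType}.
Implicit Types V W M : normedModType R.

(** Differentiability together with the value of one directional derivative, so
    that both are propagated by the same rules. *)
Definition der {V} (f : V -> R) (p v : V) (d : R) :=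
  differentiable f p /\ 'D_v f p = d.

Lemma derP {V} (f : V -> R) p v : differentiable f p -> der f p v ('D_v f p).
Proof. by []. Qed.

Lemma der_eq {V} (f : V -> R) p v d d' : der f p v d -> d = d' -> der f p v d'.
Proof. by move=> H <-. Qed.

Lemma der_clin {V} (l : V -> R) p v : clin l -> der l p v (l v).
Proof. by move=> cl; split; [exact: clin_differentiable|exact: clin_derive]. Qed.

Lemma der_coord (p v : plane R) j : der (fun q : plane R => q 0 j) p v (v 0 j).
Proof. exact: der_clin (clin_coord j). Qed.

Lemma der_cst {V} (c : R) (p v : V) : der (fun _ => c) p v 0.
Proof. by split; [exact: differentiable_cst|exact: derive_cst]. Qed.

Lemma der_add {V} (f g : V -> R) p v a b : der f p v a -> der g p v b ->
  der (fun q => f q + g q) p v (a + b).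
Proof.
move=> [df <-] [dg <-]; split; first exact: differentiableD.
by apply: deriveD; exact: diff_derivable.
Qed.

Lemma der_opp {V} (f : V -> R) p v a : der f p v a ->
  der (fun q => - f q) p v (- a).
Proof.
move=> [df <-]; split; first exact: differentiableN.
by apply: deriveN; exact: diff_derivable.
Qed.

Lemma der_mul {V} (f g : V -> R) p v a b : der f p v a -> der g p v b ->
  der (fun q => f q * g q) p v (f p * b + g p * a).
Proof.
move=> [df <-] [dg <-]; split; first exact: differentiableM.
by apply: deriveM; exact: diff_derivable.
Qed.

Lemma der_comp {V} (a b : V -> R) (g : plane R -> R) p v da db :
  der a p v da -> der b p v db -> differentiable g (pt (a p) (b p)) ->
  der (fun q => g (pt (a q) (b q))) p v
    (da * d1 g (pt (a p) (b p)) + db * d2 g (pt (a p) (b p))).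
Proof.
move=> [dfa <-] [dfb <-] dg.
have dp : differentiable (fun q => pt (a q) (b q)) p by exact: differentiable_pt.
split; first exact: (@differentiable_comp _ _ _ _ (fun q => pt (a q) (b q)) g).
rewrite -[LHS]/('D_v (g \o (fun q => pt (a q) (b q))) p) derive_plane //.
have -> : (fun q => pt (a q) (b q) 0 0) = a by apply/funext => q; rewrite ptE.
have -> : (fun q => pt (a q) (b q) 0 1) = b by apply/funext => q; rewrite ptE.
by [].
Qed.

(** The inverse is the implicit function t of the equation g (x, t) = s.  The
    nonlinear changes of coordinates below are all composed of maps of this
    triangular form. *)
Lemma triangular_diffeo (g : plane R -> R) :
  smooth_germ g -> g 0 = 0 -> d2 g 0 != 0 ->
  exists tau : plane R -> R, [/\ smooth_germ tau, tau 0 = 0 &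
    inverse_diffeo_germs (fun p => pt (p 0 0) (g p)) (fun p => pt (p 0 0) (tau p))].
Proof.
move=> sg g0 dg0.
pose x (z : plane R * R) : R := z.1 0 0.
pose s (z : plane R * R) : R := z.1 0 1.
pose t (z : plane R * R) : R := z.2.
have cx : clin x by exact: (clin_comp clin_fst (clin_coord 0)).
have cs : clin s by exact: (clin_comp clin_fst (clin_coord 1)).
have ct : clin t by exact: clin_snd.
have z0 : pt (x 0) (t 0) = 0 by rewrite /x /t /= mxE pt00.
have sxt : smooth_germ (fun z => pt (x z) (t z)) by apply: germ_pt; exact: germ_clin.
pose Phi z := g (pt (x z) (t z)) - s z.
have sPhi : smooth_germ Phi.
  apply: germ_add; first exact: germ_comp.
  by apply: germ_opp; exact: germ_clin.
have Phi0 : Phi 0 = 0 by rewrite /Phi z0 g0 /s /= mxE subr0.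
have dPhi : 'D_(0, 1) Phi 0 != 0.
  have dg : differentiable g (pt (x 0) (t 0)) by rewrite z0; exact: germ_diff.
  pose e : plane R * R := (0, 1).
  have [_ H] := der_add (der_comp (der_clin (0 : plane R * R) e cx)
    (der_clin 0 e ct) dg) (der_opp (der_clin 0 e cs)).
  by rewrite [X in X != _]H z0 /x /s /t /= !mxE mul0r add0r mul1r oppr0 addr0.
have [w [sw w0 h1 h2]] := implicit_function sPhi Phi0 dPhi.
have m1 : map_germ (fun p : plane R => pt (p 0 0) (g p)).
  by apply: map_germ_pt => //; [exact: germ_coord|rewrite mxE].
have m2 : map_germ (fun p : plane R => pt (p 0 0) (w p)).
  by apply: map_germ_pt => //; [exact: germ_coord|rewrite mxE].
exists w; split=> //; split=> //.
- pose f (p : plane R) : plane R * R := (pt (p 0 0) (g p), p 0 1).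
  have sf : smooth_germ f.
    have [U [oU hf hg]] := germ_two m1.1 (germ_coord 1).
    by exists U => // k; exact: (Ck_pair oU.1 (hf k) (hg k)).
  have f0 : f 0 = 0 by rewrite /f g0 !mxE pt00.
  apply: filterS (near_comp sf f0 h2) => p; rewrite /Phi /f /x /s /t /= !ptE pt_eta subrr.
  by move=> /(_ erefl) <-; rewrite pt_eta.
- apply: filterS h1 => p; rewrite /Phi /x /s /t /= !ptE => /eqP.
  by rewrite subr_eq0 => /eqP ->; rewrite pt_eta.
Qed.

Definition swap (p : plane R) : plane R := pt (p 0 1) (p 0 0).

Lemma swapK : cancel swap swap.
Proof. by move=> p; rewrite /swap !ptE pt_eta. Qed.

Lemma map_germ_swap : map_germ swap.
Proof. by apply: map_germ_pt; rewrite ?mxE //; exact: germ_coord. Qed.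

Lemma diffeo_swap : inverse_diffeo_germs swap swap.
Proof.
by apply: diffeo_intro;
  [exact: map_germ_swap|exact: map_germ_swap|exact: swapK|exact: swapK].
Qed.

Lemma triangular_diffeo_fst (g : plane R -> R) :
  smooth_germ g -> g 0 = 0 -> d1 g 0 != 0 ->
  exists rho : plane R -> R, [/\ smooth_germ rho, rho 0 = 0 &
    inverse_diffeo_germs (fun p => pt (g p) (p 0 1)) (fun p => pt (rho p) (p 0 1))].
Proof.
move=> sg g0 dg0; have [ss s0] := map_germ_swap.
have sg' : smooth_germ (fun p => g (swap p)) by exact: germ_comp.
have g0' : g (swap 0) = 0 by rewrite s0.
have dg' : d2 (fun p => g (swap p)) 0 != 0.
  have dg : differentiable g (pt ((0 : plane R) 0 1) ((0 : plane R) 0 0)).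
    by rewrite !mxE pt00; exact: germ_diff.
  have [_ H] := der_comp (der_coord 0 (pt 0 1) 1) (der_coord 0 (pt 0 1) 0) dg.
  by rewrite /d2 [X in X != _]H !ptE mul1r mul0r addr0 !mxE pt00.
have [tau [st t0 dt]] := triangular_diffeo sg' g0' dg'.
exists (fun p => tau (swap p)); split; [exact: germ_comp|by rewrite s0|].
have := diffeo_comp diffeo_swap (diffeo_comp dt diffeo_swap).
congr inverse_diffeo_germs; apply/funext => p /=.
  by rewrite {1}/swap !ptE swapK.
by rewrite {1}/swap !ptE.
Qed.

Lemma det2 (A : 'M[R]_2) : \det A = A 0 0 * A 1 1 - A 0 1 * A 1 0.
Proof.
rewrite (expand_det_row _ 0) !big_ord_recl big_ord0 addr0.
rewrite /cofactor !det_mx11 !mxE /= expr0 expr1 mul1r mulN1r mulrN.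
by congr (A _ _ * A _ _ - A _ _ * A _ _); apply: val_inj.
Qed.

Lemma jacobianE (f : plane R -> plane R) p i j : differentiable f p ->
  'J f p i j = 'D_(ebase i) (fun q => f q 0 j) p.
Proof.
move=> df; rewrite -derive_coord // deriveE // mxE.
congr ('d f p _ 0 j); apply/plane_ext; rewrite !mxE eqxx /=.
  by case: i => [[|[|//]]].
by case: i => [[|[|//]]].
Qed.

Lemma criminant_eqE (f : plane R -> plane R) p : differentiable f p ->
  criminant_eq f p = d1 (fun q => f q 0 0) p * d2 (fun q => f q 0 1) p
                   - d1 (fun q => f q 0 1) p * d2 (fun q => f q 0 0) p.
Proof.
move=> df; rewrite -[LHS]/(\det ('J f p)) det2 !jacobianE //.
Qed.

Lemma mulmx_jacobian (f : plane R -> plane R) p v : v *m 'J f p = 'd f p v.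
Proof. exact: mul_rV_lin1. Qed.

Lemma criminant_comp (f g : plane R -> plane R) p :
  differentiable f p -> differentiable g (f p) ->
  criminant_eq (g \o f) p = criminant_eq f p * criminant_eq g (f p).
Proof.
move=> df dg; rewrite -[LHS]/(\det ('J (g \o f) p)).
rewrite -[RHS]/(\det ('J f p) * \det ('J g (f p))).
rewrite -det_mulmx; congr (\det _); apply/row_matrixP => i.
apply: etrans (rowE _ _) _; apply: etrans _ (esym (rowE _ _)).
apply: etrans (mulmx_jacobian _ _ _) _.
apply: etrans _ (esym (mulmxA _ _ _)).
apply: etrans _ (esym (congr1 (mulmx^~ _) (mulmx_jacobian f p _))).
apply: etrans _ (esym (mulmx_jacobian g (f p) _)).
have H := diff_comp df dg; exact: (congr1 (fun h => h (delta_mx 0 i)) H).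
Qed.

Lemma criminant_id p : criminant_eq (@id (plane R)) p = 1.
Proof.
rewrite criminant_eqE; last exact: clin_differentiable clin_id.
by rewrite /d1 /d2 !derive_coord_plane !ptE mulr1 mul0r subr0.
Qed.

Lemma criminant_near (f g : plane R -> plane R) p : differentiable f p ->
  (\forall q \near p, f q = g q) -> criminant_eq f p = criminant_eq g p.
Proof.
move=> df fg; have dg := near_differentiable fg df.
rewrite !criminant_eqE // /d1 /d2.
have H v j : 'D_v (fun q => f q 0 j) p = 'D_v (fun q => g q 0 j) p.
  by apply: near_eq_derive; apply: filterS fg => q ->.
by rewrite !H.
Qed.

Lemma germ_criminant (f : plane R -> plane R) : smooth_germ f ->
  smooth_germ (criminant_eq f).
Proof.
move=> sf.
have H : smooth_germ (fun p => d1 (fun q => f q 0 0) p * d2 (fun q => f q 0 1) p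
                   - d1 (fun q => f q 0 1) p * d2 (fun q => f q 0 0) p).
  apply: germ_add; last apply: germ_opp; apply: germ_mul;
    by apply: germ_D; exact: germ_coordf.
apply: germ_eq H; apply: filterS (germ_near sf) => p dp.
by rewrite criminant_eqE.
Qed.

Lemma diffeo_criminant (phi phi' : plane R -> plane R) :
  inverse_diffeo_germs phi phi' -> criminant_eq phi 0 != 0.
Proof.
move=> [mphi mphi' e _].
have d0 := germ_diff mphi.1; have d0' := germ_diff mphi'.1.
have : criminant_eq (phi' \o phi) 0 = 1.
  rewrite -(criminant_id 0); apply: criminant_near => //.
  by apply: differentiable_comp => //; rewrite mphi.2.
rewrite criminant_comp //; last by rewrite mphi.2.
by move=> H; apply: contra_eq_neq H => ->; rewrite mul0r eq_sym oner_neq0.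
Qed.

Lemma near_open_near {V} (P : V -> Prop) : (\forall p \near (0 : V), P p) ->
  \forall p \near (0 : V), \forall q \near p, P q.
Proof.
move=> /near_open[U oU PU]; apply: filterS (open_nbhs_nbhs oU) => p Up.
exact: filterS PU (open_nbhs_nbhs (conj oU.1 Up)).
Qed.

(** By the chain rule, the Jacobian determinants of A-equivalent germs differ by
    a change of coordinates in the source and by a nonvanishing factor. *)
Lemma criminant_transfer (f g phi phi' psi psi' : plane R -> plane R) :
  map_germ f -> inverse_diffeo_germs phi phi' -> inverse_diffeo_germs psi psi' ->
  (\forall p \near (0 : plane R), g p = psi (f (phi' p))) ->
  exists u : plane R -> R, [/\ smooth_germ u, u 0 != 0 &
    \forall p \near (0 : plane R), criminant_eq g p = u p * criminant_eq f (phi' p)].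
Proof.
move=> mf dphi dpsi e.
have [_ mphi' _ _] := dphi; have [mpsi _ _ _] := dpsi.
have mfp := map_germ_comp mphi' mf.
exists (fun p => criminant_eq phi' p * criminant_eq psi (f (phi' p))); split.
- apply: germ_mul; first exact: germ_criminant mphi'.1.
  exact: (germ_comp mfp.1 mfp.2 (germ_criminant mpsi.1)).
- rewrite mphi'.2 mf.2 mulf_neq0 //; first exact: diffeo_criminant (diffeo_sym dphi).
  exact: diffeo_criminant dpsi.
- have n1 := germ_near mphi'.1.
  have n2 := near_comp mphi'.1 mphi'.2 (germ_near mf.1).
  have n3 := near_comp mfp.1 mfp.2 (germ_near mpsi.1).
  have n4 := near_open_near e.
  apply: filterS2 (filterI n1 n2) (filterI n3 n4) => p [h1 h2] [h3 h4].
  have df : differentiable (f \o phi') p by exact: differentiable_comp.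
  have dp : differentiable (psi \o (f \o phi')) p by exact: differentiable_comp.
  rewrite -(@criminant_near (psi \o (f \o phi')) g p) //; last by apply: filterS h4 => q ->.
  rewrite (criminant_comp df h3) (criminant_comp h1 h2).
  exact: mulrAC.
Qed.

End Derivations.

(** * Coordinates adapted to the support *)

Section Prenormal.
Context {R : realType}.
Implicit Types V W M : normedModType R.

(** The shape that a tangential family takes in adapted coordinates: the curves
    are parameterized by x = p 0 0, the support is the x-axis, and the
    factor t^2 (t = p 0 1) says that the curves are tangent to it. *)
Definition prenormal (H : plane R -> R) (p : plane R) : plane R :=
  pt (p 0 0) (p 0 1 ^+ 2 * H p).

(** Taking the first component f_0 of f as a new source coordinate puts f in the
    form (x, F (x, t)); subtracting F (x, 0) in the target flattens the
    support.  The implicit function rho has rho_t = - c, where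
    d_t f = c d_xi f on t = 0, hence F_t = c (d_xi f_1) - c (d_xi f_1) = 0
    there, and F (x, t) - F (x, 0) is divisible by t^2. *)
Lemma prenormal_fst (f : plane R -> plane R) : map_germ f ->
  d_xi f 0 0 0 != 0 ->
  (\forall x \near (0 : R), exists c : R, d_t f (pt x 0) = c *: d_xi f (pt x 0)) ->
  exists phi phi' psi psi' H,
    [/\ inverse_diffeo_germs phi phi', inverse_diffeo_germs psi psi', smooth_germ H &
      \forall p \near (0 : plane R), psi (f (phi' p)) = prenormal H p].
Proof.
move=> mf df0 tan; have [sf f0] := mf.
pose a q := f q 0 0; pose b q := f q 0 1.
have sa : smooth_germ a by exact: germ_coordf.
have sb : smooth_germ b by exact: germ_coordf.
have a0 : a 0 = 0 by rewrite /a f0 mxE.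
have b0 : b 0 = 0 by rewrite /b f0 mxE.
have da0 : d1 a 0 != 0.
  by rewrite /d1 /a -derive_coord //; exact: germ_diff.
have [rho [srho rho0 dphi]] := triangular_diffeo_fst sa a0 da0.
pose phi' (p : plane R) := pt (rho p) (p 0 1).
have [_ mphi' _ e2] : inverse_diffeo_germs (fun p => pt (a p) (p 0 1)) phi' := dphi.
pose F p := b (phi' p).
have sF : smooth_germ F by exact: (germ_comp mphi'.1 mphi'.2 sb).
have F0 : F 0 = 0 by rewrite /F mphi'.2.
have cfoot : clin (@foot R).
  have -> : @foot R = (fun r : R => r *: (pt 1 0 : plane R)) \o (fun p : plane R => p 0 0).
    by apply/funext => p; rewrite /= ptZ mulr1 mulr0.
  exact: (clin_comp (clin_coord 0) (clin_scale _)).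
have sfoot : smooth_germ (@foot R) by exact: germ_clin.
have foot0 : foot (0 : plane R) = 0 by rewrite /foot mxE pt00.
have sFf : smooth_germ (fun p => F (foot p)) by exact: germ_comp.
pose psi (p : plane R) := pt (p 0 0) (p 0 1 - F (foot p)).
pose psi1 (p : plane R) := pt (p 0 0) (p 0 1 + F (foot p)).
have foot_pt (x y : R) : foot (pt x y) = pt x 0 by rewrite /foot ptE.
have dpsi : inverse_diffeo_germs psi psi1.
  apply: diffeo_intro.
  - apply: map_germ_pt; rewrite ?foot0 ?F0 ?mxE ?subr0 //; first exact: germ_coord.
    by apply: germ_add; [exact: germ_coord|exact: germ_opp].
  - apply: map_germ_pt; rewrite ?foot0 ?F0 ?mxE ?addr0 //; first exact: germ_coord.
    by apply: germ_add; [exact: germ_coord|].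
  - by move=> p; rewrite /psi1 /psi !ptE foot_pt subrK pt_eta.
  - by move=> p; rewrite /psi1 /psi !ptE foot_pt addrK pt_eta.
pose G p := F p - F (foot p).
have sG : smooth_germ G by apply: germ_add => //; exact: germ_opp.
have E : \forall p \near (0 : plane R), psi (f (phi' p)) = pt (p 0 0) (G p).
  apply: filterS e2 => p; rewrite ptE => e.
  have ea : a (phi' p) = p 0 0 by have := congr1 (fun q : plane R => q 0 0) e; rewrite !ptE.
  have -> : f (phi' p) = pt (p 0 0) (F p) by apply: plane_ext; rewrite ptE.
  by rewrite /psi !ptE foot_pt.
suff [H sH eH] : exists2 H : plane R -> R, smooth_germ H &
    \forall p \near (0 : plane R), G p = (p : plane R) 0 1 ^+ 2 * H p.
  exists (fun p => pt (a p) (p 0 1)), phi', psi, psi1, H; split=> //.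
  by apply: filterS2 E eH => p -> ->.
apply: hadamard => //.
have n1 := near_comp srho rho0 tan.
have n2 : \forall p \near (0 : plane R), [/\ differentiable f (phi' p),
   differentiable a (phi' p) & differentiable b (phi' p)].
  have h1 := near_comp mphi'.1 mphi'.2 (germ_near sf).
  have h2 := near_comp mphi'.1 mphi'.2 (germ_near sa).
  have h3 := near_comp mphi'.1 mphi'.2 (germ_near sb).
  by apply: filterS3 h1 h2 h3 => p.
have n3 := germ_near srho.
have n4 : \forall p \near (0 : plane R), d1 a (phi' p) != 0.
  have sda : smooth_germ (d1 a) := germ_D (pt 1 0) sa.
  exact: (near_comp mphi'.1 mphi'.2 (germ_near_neq0 sda da0)).
have n5 := near_open_near e2.
have n6 := germ_near sF.
apply: filterS3 (filterI n1 n2) (filterI n3 n4) (filterI n5 n6).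
move=> p [[c tc] [df da db]] [drho da1] [ep dF] p1 [|[|//]] _ /=.
  by rewrite /G (foot_id p1) subrr.
have ephi : phi' p = pt (rho p) 0 by rewrite /phi' p1.
have [tca tcb] : d2 a (phi' p) = c * d1 a (phi' p) /\ d2 b (phi' p) = c * d1 b (phi' p).
  rewrite /d1 /d2 /a /b -!derive_coord // ephi -/(d_t f _) tc.
  by rewrite !mxE.
have dr := derP (pt 0 1) drho.
have dt := der_coord p (pt 0 1) 1.
have [_ ea] := der_comp dr dt da.
have [_ eb] := der_comp dr dt db.
have ea0 : 'D_(pt 0 1) (fun q => a (pt (rho q) (q 0 1))) p = 0.
  rewrite (@near_eq_derive _ _ _ _ (fun q : plane R => q 0 0)).
    by rewrite derive_coord_plane ptE.
  apply: filterS ep => q; rewrite ptE => e.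
  by have := congr1 (fun q : plane R => q 0 0) e; rewrite !ptE.
rewrite ea0 ptE mul1r -/(phi' p) tca in ea.
rewrite ptE mul1r -/(phi' p) tcb in eb.
(* Differentiate f_0 (rho (x, t), t) = x along t. *)
have rc : 'D_(pt 0 1) rho p = - c.
  apply/eqP; rewrite -addr_eq0; apply/eqP.
  by apply: (mulIf da1); rewrite mul0r mulrDl -ea.
rewrite rc mulNr addNr in eb.
have dFf : differentiable F (foot p) by rewrite (foot_id p1).
have dFfc : differentiable (F \o @foot R) p.
  by apply: differentiable_comp => //; exact: clin_differentiable.
have [_ eG] := der_add (derP (pt 0 1) dF) (der_opp (derP (pt 0 1) dFfc)).
apply: etrans eG _.
by rewrite (derive_foot _ dFf) ptE mul0r subr0.
Qed.

Lemma clin_swap : clin (@swap R).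
Proof.
have -> : @swap R = (fun p =>
    ((fun r : R => r *: (pt 1 0 : plane R)) \o (fun p : plane R => p 0 1)) p
    + ((fun r : R => r *: (pt 0 1 : plane R)) \o (fun p : plane R => p 0 0)) p).
  by apply/funext => p /=; rewrite !ptZ ptD !mulr1 !mulr0 addr0 add0r.
move=> p; apply: is_diffD.
  exact: (clin_comp (clin_coord 1) (clin_scale _)).
exact: (clin_comp (clin_coord 0) (clin_scale _)).
Qed.

(** One of the two components of the support has a nonzero derivative; if it is
    the second one, exchange the two target coordinates. *)
Lemma prenormalize (f : plane R -> plane R) : tangential_family_germ f ->
  exists phi phi' psi psi' H,
    [/\ inverse_diffeo_germs phi phi', inverse_diffeo_germs psi psi', smooth_germ H &
      \forall p \near (0 : plane R), psi (f (phi' p)) = prenormal H p].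
Proof.
move=> [mf _ tan _].
have [xi0 _ _] := nbhs_singleton tan; rewrite pt00 in xi0.
have tan' : \forall x \near (0 : R), exists c : R, d_t f (pt x 0) = c *: d_xi f (pt x 0).
  apply: filterS tan => x [h1 h2 [c hc]]; exists c^-1.
  have c0 : c != 0 by apply: contra_not_neq h1 => c0; rewrite hc c0 scale0r.
  by rewrite hc scalerA mulVf // scale1r.
have [x0|x0] := eqVneq (d_xi f 0 0 0) 0; last exact: prenormal_fst.
have x1 : d_xi f 0 0 1 != 0.
  by apply: contra_not_neq xi0 => x1; apply: plane_ext; rewrite mxE.
have mg : map_germ (fun p => swap (f p)) by exact: (map_germ_comp mf (@map_germ_swap R)).
have Dg v p : differentiable f p -> 'D_v (fun p => swap (f p)) p = swap ('D_v f p).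
  by move=> df; rewrite -(derive_clin_comp _ clin_swap).
have [||phi [phi' [psi [psi' [H [h1 h2 h3 h4]]]]]] := prenormal_fst mg.
- by rewrite /d_xi Dg ?ptE //; exact: germ_diff mf.1.
- have n0 : \forall x \near (0 : R), differentiable f (pt x 0).
    have sp : smooth_germ (fun x : R => pt x 0 : plane R).
      by apply: germ_pt; [exact: germ_clin clin_id|exact: germ_cst].
    exact: (near_comp sp (@pt00 R) (germ_near mf.1)).
  apply: filterS2 n0 tan' => x df [c hc]; exists c.
  rewrite /d_xi /d_t !Dg // -/(d_t f _) hc /d_xi.
  by apply: plane_ext; rewrite !mxE.
exists phi, phi', (psi \o @swap R), (@swap R \o psi'), H; split=> //.
exact: diffeo_comp (@diffeo_swap R) h2.
Qed.

End Prenormal.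

(** * Normal form of the fold *)

Section NormalForms.
Context {R : realType}.
Implicit Types V W M : normedModType R.

Lemma germ_fst (g : plane R -> R) : smooth_germ g ->
  smooth_germ (fun z : plane R * R => g z.1).
Proof. by move=> sg; apply: (germ_comp _ _ sg) => //; exact: germ_clin clin_fst. Qed.

Lemma der_fst (g : plane R -> R) : smooth_germ g ->
  der (fun z : plane R * R => g z.1) 0 ((0, 1) : plane R * R) 0.
Proof.
move=> sg; have dg : differentiable g (@fst (plane R) R 0) by exact: germ_diff.
have df : differentiable (@fst (plane R) R) 0 by exact: clin_differentiable clin_fst.
split; first exact: (@differentiable_comp _ _ _ _ (@fst (plane R) R) g).
have := derive_comp ((0, 1) : plane R * R) df dg.
by rewrite (clin_derive _ _ clin_fst) /= linear0.
Qed.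

(** Both normal forms are reached by multiplying or correcting the coordinate t
    by a function w, and comparing the two sides leaves an equation of degree
    at most three for w, with coefficients depending on the point. *)
Lemma implicit_cubic (A B Q : plane R -> R) (w0 : R) :
  smooth_germ A -> smooth_germ B -> smooth_germ Q ->
  w0 + A 0 * w0 ^+ 2 + B 0 * w0 ^+ 3 = Q 0 ->
  1 + 2 * A 0 * w0 + 3 * B 0 * w0 ^+ 2 != 0 ->
  exists w : plane R -> R, [/\ smooth_germ w, w 0 = w0 &
    \forall p \near (0 : plane R), w p + A p * w p ^+ 2 + B p * w p ^+ 3 = Q p].
Proof.
move=> sA sB sQ E0 D0.
pose W (z : plane R * R) : R := w0 + z.2.
have sW : smooth_germ W by apply: germ_add; [exact: germ_cst|exact: germ_clin clin_snd].
pose Phi (z : plane R * R) := W z + A z.1 * (W z * W z) + B z.1 * (W z * (W z * W z)) - Q z.1.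
have sPhi : smooth_germ Phi.
  apply: germ_add; last by apply: germ_opp; exact: germ_fst.
  apply: germ_add; last by apply: germ_mul; [exact: germ_fst|do 2 apply: germ_mul => //].
  by apply: germ_add => //; apply: germ_mul; [exact: germ_fst|exact: germ_mul].
have W0 : W 0 = w0 by rewrite /W addr0.
have Phi0 : Phi 0 = 0.
  by rewrite /Phi W0 /= -E0; ring.
pose e : plane R * R := (0, 1).
have dW : der W 0 e 1.
  exact: der_eq (der_add (der_cst w0 0 e) (der_clin 0 e clin_snd)) (add0r 1).
have dPhi : 'D_e Phi 0 != 0.
  have dWW := der_mul dW dW.
  have [_ H] := der_add (der_add (der_add dW (der_mul (der_fst sA) dWW))
    (der_mul (der_fst sB) (der_mul dW dWW))) (der_opp (der_fst sQ)).
  rewrite [X in X != _]H W0 /=; apply: contra_neq D0 => <-; ring.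
have [v [sv v0 h _]] := implicit_function sPhi Phi0 dPhi.
exists (fun p => w0 + v p); split.
- by apply: germ_add => //; exact: germ_cst.
- by rewrite v0 addr0.
- apply: filterS h => p; rewrite /Phi /W /= => /eqP; rewrite subr_eq0 => /eqP <-.
  ring.
Qed.

(** The factor m is taken at the foot of p, so that it is not changed by the
    scaling itself. *)
Lemma diffeo_scale_snd (m : plane R -> R) : smooth_germ m -> m 0 != 0 ->
  inverse_diffeo_germs (fun p : plane R => pt (p 0 0) (p 0 1 * m (foot p)))
                       (fun p : plane R => pt (p 0 0) (p 0 1 * (m (foot p))^-1)).
Proof.
move=> sm m0.
have foot0 : foot (0 : plane R) = 0 by rewrite /foot mxE pt00.
have sfoot : smooth_germ (@foot R) by apply: germ_pt; [exact: germ_coord|exact: germ_cst].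
have smf : smooth_germ (fun p => m (foot p)) by exact: germ_comp.
have nz : \forall p \near (0 : plane R), m (foot p) != 0.
  by apply: (germ_near_neq0 smf); rewrite foot0.
have foot_pt (x y : R) : foot (pt x y) = pt x 0 by rewrite /foot ptE.
split.
- apply: map_germ_pt; rewrite ?mxE ?mul0r //; first exact: germ_coord.
  by apply: germ_mul => //; exact: germ_coord.
- apply: map_germ_pt; rewrite ?mxE ?mul0r //; first exact: germ_coord.
  apply: germ_mul; first exact: germ_coord.
  by apply: germ_inv => //; rewrite foot0.
- by apply: filterS nz => p m1; rewrite !ptE foot_pt mulfK // pt_eta.
- by apply: filterS nz => p m1; rewrite !ptE foot_pt divfK // pt_eta.
Qed.

Lemma diffeo_shear (c : R) : c != 0 ->
  inverse_diffeo_germs (fun p : plane R => pt (c * p 0 0 - p 0 1) (p 0 1))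
                       (fun p : plane R => pt (c^-1 * (p 0 0 + p 0 1)) (p 0 1)).
Proof.
move=> c0; have s0 := @germ_coord R 0; have s1 := @germ_coord R 1.
apply: diffeo_intro.
- apply: map_germ_pt; rewrite ?mxE ?mulr0 ?subr0 //.
  by apply: germ_add; [apply: germ_mul => //; exact: germ_cst|exact: germ_opp].
- apply: map_germ_pt; rewrite ?mxE ?addr0 ?mulr0 //.
  by apply: germ_mul; [exact: germ_cst|exact: germ_add].
- by move=> p; rewrite !ptE subrK mulKf // pt_eta.
- by move=> p; rewrite !ptE mulVKf // addrK pt_eta.
Qed.

Lemma diffeo_scale_fst (c : R) : c != 0 ->
  inverse_diffeo_germs (fun p : plane R => pt (c * p 0 0) (p 0 1))
                       (fun p : plane R => pt (c^-1 * p 0 0) (p 0 1)).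
Proof.
move=> c0; have s0 := @germ_coord R 0; have s1 := @germ_coord R 1.
apply: diffeo_intro.
- by apply: map_germ_pt; rewrite ?mxE ?mulr0 //; apply: germ_mul => //; exact: germ_cst.
- by apply: map_germ_pt; rewrite ?mxE ?mulr0 //; apply: germ_mul => //; exact: germ_cst.
- by move=> p; rewrite !ptE mulKf // pt_eta.
- by move=> p; rewrite !ptE mulVKf // pt_eta.
Qed.

Lemma diffeo_stretch (u : plane R -> R) : smooth_germ u -> u 0 != 0 ->
  exists phi, inverse_diffeo_germs (fun p : plane R => pt (p 0 0) (p 0 1 * u p)) phi.
Proof.
move=> su u0; have s1 := @germ_coord R 1.
have ss : smooth_germ (fun p : plane R => p 0 1 * u p) by exact: germ_mul.
have s00 : (0 : plane R) 0 1 * u 0 = 0 by rewrite mxE mul0r.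
have ds : d2 (fun p : plane R => p 0 1 * u p) 0 != 0.
  have [_ H] := der_mul (der_coord 0 (pt 0 1) 1) (derP (pt 0 1) (germ_diff su)).
  by rewrite /d2 [X in X != _]H mxE mul0r add0r ptE mulr1.
have [tau [_ _ h]] := triangular_diffeo ss s00 ds.
by exists (fun p : plane R => pt (p 0 0) (tau p)).
Qed.

(** If H does not vanish then t^2 H / H(0) = s^2, where s = t (1 + w) and
    (1 + w)^2 = H / H(0) is solved for w; thus (x, t^2 H) becomes (x, s^2),
    and x = xi + s puts it into the normal form. *)
Lemma prenormal_fold (H : plane R -> R) : smooth_germ H -> H 0 != 0 ->
  A_equivalent normal_form_I (prenormal H).
Proof.
move=> sH H0.
(* (1 + w)^2 = H / H(0) reads w + w^2 / 2 = Q. *)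
pose Q p := 2^-1 * (H p * (H 0)^-1 - 1).
have sQ : smooth_germ Q.
  apply: germ_mul; first exact: germ_cst.
  by apply: germ_add; [apply: germ_mul => //; exact: germ_cst|exact: germ_cst].
have [||||w [sw w0 hw]] := @implicit_cubic (fun=> 2^-1) (fun=> 0) Q 0 _ _ sQ.
- exact: germ_cst.
- exact: germ_cst.
- by rewrite /Q divff // subrr; ring.
- by rewrite !mulr0 mul0r !addr0 oner_neq0.
have su : smooth_germ (fun p => 1 + w p) by apply: germ_add => //; exact: germ_cst.
have u0 : 1 + w 0 != 0 by rewrite w0 addr0 oner_neq0.
have [phi dS] := diffeo_stretch su u0.
have dL := diffeo_shear (oner_neq0 R).
have dT := diffeo_scale_snd (@germ_cst R _ R (H 0)) H0.
do 4 eexists; split; [exact: diffeo_sym (diffeo_comp dS dL)|exact: dT|].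
apply: filterS hw => p hp /=.
rewrite /normal_form_I /prenormal !ptE; congr pt; first by ring.
have -> : H p = H 0 * (1 + 2 * Q p) by rewrite /Q; field.
by rewrite -hp; field.
Qed.

End NormalForms.

(** * Normal form of the beaks *)

Section Beaks.
Context {R : realType}.
Implicit Types V W M : normedModType R.

Definition diag (p : plane R) : plane R := pt (p 0 0) (p 0 0).

(** The hypotheses say that F = t^2 H has, for fixed x, the critical points
    t = 0 and t = x and there the same critical values 0 and x^3 / 2 as the
    cubic N (x, t) = t^2 (3 x / 2 - t).  Then F - N vanishes to order two on both
    lines, F - N = t^2 (t - x)^2 Q.  Looking for s = t + t (t - x) w such that
    N (x, s) = F (x, t), the factor t^2 (t - x)^2 cancels, because
    dN/dt = - 3 t (t - x), and there remains the equation
    w + (t - x / 2) w^2 + t (t - x) w^3 / 3 = - Q / 3,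
    which [implicit_cubic] solves.  Finally (x, N (x, s)) is the normal form up
    to linear changes of coordinates. *)
Lemma beaks_of_diagonal (H : plane R -> R) : smooth_germ H ->
  (\forall p \near (0 : plane R), H (diag p) = (p : plane R) 0 0 / 2) ->
  (\forall p \near (0 : plane R), d2 H (diag p) = -1) ->
  A_equivalent normal_form_II (prenormal H).
Proof.
move=> sH hH hD.
have s0 := @germ_coord R 0; have s1 := @germ_coord R 1.
pose P (p : plane R) := 3 / 2 * p 0 0 - p 0 1.
have sP : smooth_germ P.
  by apply: germ_add; [apply: germ_mul => //; exact: germ_cst|exact: germ_opp].
pose E p := H p - P p.
have sE : smooth_germ E by apply: germ_add => //; exact: germ_opp.
pose up (p : plane R) := pt (p 0 0) (p 0 0 + p 0 1).
pose down (p : plane R) := pt (p 0 0) (p 0 1 - p 0 0).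
have mup : map_germ up by apply: map_germ_pt; rewrite ?mxE ?addr0 //; exact: germ_add.
have mdown : map_germ down.
  by apply: map_germ_pt; rewrite ?mxE ?subr0 //; apply: germ_add => //; exact: germ_opp.
(* The shear up carries the axis t = 0 to the diagonal, where E = H - P
   vanishes to order two. *)
pose E' p := E (up p).
have sE' : smooth_germ E' by exact: (germ_comp mup.1 mup.2 sE).
have up_diag (p : plane R) : p 0 1 = 0 -> up p = diag p by rewrite /up /diag => ->; rewrite addr0.
have [Q sQ hQ] : exists2 Q : plane R -> R, smooth_germ Q &
    \forall p \near (0 : plane R), E' p = (p : plane R) 0 1 ^+ 2 * Q p.
  apply: hadamard => //.
  have n1 := near_comp mup.1 mup.2 (germ_near sH).
  apply: filterS3 hH hD n1 => p h h' dH p1 [|[|//]] _ /=.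
    by rewrite /E' (up_diag _ p1) /E /P h /diag !ptE; field.
  have dP : der P (up p) (pt 0 1) (-1).
    apply: der_eq (der_add (der_mul (der_cst _ _ _) (der_coord _ _ 0))
      (der_opp (der_coord _ _ 1))) _.
    by rewrite !ptE !mulr0 !add0r.
  have dE := der_add (derP (pt 0 1) dH) (der_opp dP).
  have d01 := der_add (der_coord p (pt 0 1) 0) (der_coord p (pt 0 1) 1).
  have [_ HE] := der_comp (der_coord p (pt 0 1) 0) d01 dE.1.
  apply: etrans HE _; rewrite !ptE mul0r !add0r mul1r.
  apply: etrans dE.2 _.
  by rewrite -/(d2 H (up p)) (up_diag _ p1) h'; ring.
pose Q' p := - (Q (down p) / 3).
have sQd : smooth_germ (fun p => Q (down p)) by exact: (germ_comp mdown.1 mdown.2 sQ).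
have sQ' : smooth_germ Q' by apply: germ_opp; apply: germ_mul => //; exact: germ_cst.
pose A (p : plane R) := p 0 1 - p 0 0 / 2.
have sA : smooth_germ A.
  by apply: germ_add => //; apply: germ_opp; apply: germ_mul => //; exact: germ_cst.
have A0 : A 0 = 0 by rewrite /A !mxE mul0r subr0.
pose B (p : plane R) := p 0 1 * (p 0 1 - p 0 0) / 3.
have sD : smooth_germ (fun p : plane R => p 0 1 - p 0 0).
  by apply: germ_add => //; exact: germ_opp.
have sB : smooth_germ B.
  by apply: germ_mul; [exact: germ_mul|exact: germ_cst].
have B0 : B 0 = 0 by rewrite /B !mxE !mul0r.
have [||w [sw w0 hw]] := @implicit_cubic R A B Q' (Q' 0) sA sB sQ'.
- by rewrite A0 B0 !mul0r !addr0.
- by rewrite A0 B0 !mulr0 !mul0r !addr0 oner_neq0.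
pose u (p : plane R) := 1 + (p 0 1 - p 0 0) * w p.
have su : smooth_germ u by apply: germ_add; [exact: germ_cst|exact: germ_mul].
have u0 : u 0 != 0 by rewrite /u !mxE subr0 mul0r addr0 oner_neq0.
have [phi dS] := diffeo_stretch su u0.
have c0 : (3 / 2 : R) != 0 by rewrite mulf_neq0 // ?invr_eq0 ?pnatr_eq0.
have dL := diffeo_shear c0.
have dT := diffeo_sym (diffeo_scale_fst c0).
do 4 eexists; split; [exact: diffeo_sym (diffeo_comp dS dL)|exact: dT|].
have n1 := near_comp mdown.1 mdown.2 hQ.
apply: filterS2 hw n1 => p hp hq /=.
have eH : H p = P p + (p 0 1 - p 0 0) ^+ 2 * Q (down p).
  move: hq; rewrite /E' /up /down !ptE addrCA subrr addr0 pt_eta /E => <-.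
  by rewrite addrC subrK.
have eQ : Q (down p) = - 3 * Q' p by rewrite /Q'; field.
rewrite /normal_form_II /prenormal !ptE; congr pt; first by rewrite subrK mulKf.
by rewrite eH eQ -hp /P /u /A /B; field.
Qed.

(** Write F = t^2 H and dF/dt = t K, with K = 2 H + t H_t.  The hypotheses say
    that K = 0 is a smooth curve transversal to both coordinate axes.
    Parameterized by t it is x = sig t; the new coordinate X with x = sig X
    makes it the diagonal, and K = 0 gives there F (X, X) = X^3 n (X) / 2 with
    n = - H_t and n (0) nonzero.  Dividing the second target coordinate by n
    normalizes the critical value, and also H_t to -1 on the diagonal. *)
Lemma prenormal_beaks (H : plane R -> R) : smooth_germ H -> H 0 = 0 ->
  d1 H 0 != 0 -> d2 H 0 != 0 -> A_equivalent normal_form_II (prenormal H).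
Proof.
move=> sH H0 dH1 dH2.
have s0 := @germ_coord R 0; have s1 := @germ_coord R 1.
have sH2 : smooth_germ (d2 H) := germ_D (pt 0 1) sH.
pose K (p : plane R) := 2 * H p + p 0 1 * d2 H p.
have sK : smooth_germ K.
  by apply: germ_add; [apply: germ_mul => //; exact: germ_cst|exact: germ_mul].
have K0 : K 0 = 0 by rewrite /K H0 mxE mulr0 mul0r addr0.
have dK v : 'D_v K 0 = 2 * 'D_v H 0 + v 0 1 * d2 H 0.
  have [_ ->] := der_add (der_mul (der_cst 2 0 v) (derP v (germ_diff sH)))
    (der_mul (der_coord 0 v 1) (derP v (germ_diff sH2))).
  by rewrite mxE; ring.
have dK1 : d1 K 0 != 0.
  have e := dK (pt 1 0); rewrite pt1 mul0r addr0 in e.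
  rewrite -[d1 K 0]/('D_(pt 1 0) K 0) e.
  by apply: mulf_neq0; [rewrite pnatr_eq0|exact: dH1].
have dK2 : d2 K 0 != 0.
  rewrite /d2 dK pt1 -/(d2 H 0) mul1r.
  have -> : 2 * d2 H 0 + d2 H 0 = 3 * d2 H 0 by ring.
  by rewrite mulf_neq0 ?pnatr_eq0 //.
have [rho [srho rho0 [_ _ _ hrho]]] := triangular_diffeo_fst sK K0 dK1.
pose ax (p : plane R) := pt 0 (p 0 0).
have max : map_germ ax by apply: map_germ_pt; rewrite ?mxE //; exact: germ_cst.
pose sig p := rho (ax p).
have ssig : smooth_germ sig by exact: (germ_comp max.1 max.2 srho).
have sig0 : sig 0 = 0 by rewrite /sig max.2.
have hsig : \forall p \near (0 : plane R), K (pt (sig p) (p 0 0)) = 0.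
  apply: filterS (near_comp max.1 max.2 hrho) => p; rewrite /sig /ax !ptE => e.
  by have := congr1 (fun q : plane R => q 0 0) e; rewrite !ptE.
(* Differentiate K (sig X, X) = 0. *)
have dsig : d1 sig 0 != 0.
  have dKp : differentiable K (pt (sig 0) ((0 : plane R) 0 0)).
    by rewrite sig0 mxE pt00; exact: germ_diff.
  have [_ e] := der_comp (derP (pt 1 0) (germ_diff ssig)) (der_coord 0 (pt 1 0) 0) dKp.
  have : 'D_(pt 1 0) (fun q : plane R => K (pt (sig q) (q 0 0))) 0 = 0.
    by rewrite (near_eq_derive _ hsig); exact: derive_cst.
  rewrite e sig0 !ptE mxE pt00 mul1r => e0.
  by apply: contra_neq dK2 => h; move: e0; rewrite -/(d1 sig 0) h mul0r add0r.
have [rho2 [srho2 rho20 dSig]] := triangular_diffeo_fst ssig sig0 dsig.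
pose Sig (p : plane R) := pt (sig p) (p 0 1).
pose Sig' (p : plane R) := pt (rho2 p) (p 0 1).
have [mSig mSig' hS1 hS2] : inverse_diffeo_germs Sig Sig' := dSig.
have sig_pt (x y z : R) : sig (pt x y) = sig (pt x z) by rewrite /sig /ax !ptE.
pose H1 p := H (Sig p).
have sH1 : smooth_germ H1 by exact: (germ_comp mSig.1 mSig.2 sH).
have mprenormal (G : plane R -> R) : smooth_germ G -> map_germ (prenormal G).
  move=> sG; apply: map_germ_pt; rewrite ?mxE ?expr0n ?mul0r //.
  by apply: germ_mul => //; exact: germ_exp.
have eq1 : A_equivalent (prenormal H1) (prenormal H).
  apply: A_equivalent_sym; first exact: mprenormal.
  exists Sig', Sig, Sig', Sig; split; [exact: diffeo_sym dSig|exact: diffeo_sym dSig|].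
  have mp := mprenormal _ sH1.
  apply: filterS (near_comp mp.1 mp.2 hS1) => p e; rewrite -[LHS]e; congr Sig'.
  by rewrite /prenormal /Sig !ptE (sig_pt (p 0 0) _ (p 0 1)) pt_eta.
(* K = 0 on the diagonal says that 2 H1 = X n there. *)
pose n p := - d2 H (Sig (diag p)).
have mdiag : map_germ diag by apply: map_germ_pt; rewrite ?mxE.
have mSd := map_germ_comp mdiag mSig.
have sn : smooth_germ n by apply: germ_opp; exact: (germ_comp mSd.1 mSd.2 sH2).
have n0 : n 0 != 0 by rewrite /n mdiag.2 mSig.2 oppr_eq0.
have foot0 : foot (0 : plane R) = 0 by rewrite /foot mxE pt00.
have sfoot : smooth_germ (@foot R) by apply: germ_pt; [exact: germ_coord|exact: germ_cst].
have n_foot p : n (foot p) = n p by rewrite /n /diag /foot !ptE.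
have n_first (p : plane R) y : n (pt (p 0 0) y) = n p by rewrite /n /diag !ptE.
have n_diag p : n (diag p) = n p by rewrite /n /diag !ptE.
have sni : smooth_germ (fun p => (n p)^-1) by exact: germ_inv.
pose H2 p := H1 p * (n (foot p))^-1.
have sH2' : smooth_germ H2 := germ_mul sH1 (germ_comp sfoot foot0 sni).
have nz := germ_near_neq0 sn n0.
have eq2 : A_equivalent (prenormal H2) (prenormal H1).
  exists id, id, (fun p : plane R => pt (p 0 0) (p 0 1 * n (foot p))),
    (fun p : plane R => pt (p 0 0) (p 0 1 * (n (foot p))^-1)).
  split; [exact: diffeo_id|exact: diffeo_scale_snd|].
  apply: filterS nz => p np; rewrite /prenormal !ptE; congr pt.
  by rewrite n_foot n_first /H2 n_foot mulrA divfK.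
apply: A_equivalent_trans eq1; apply: A_equivalent_trans eq2.
have KSig : \forall p \near (0 : plane R), H1 (diag p) = (p : plane R) 0 0 * n p / 2.
  apply: filterS hsig => p; rewrite /K ptE /H1 /n /Sig /diag !ptE.
  have -> : sig (pt (p 0 0) (p 0 0)) = sig p by rewrite (sig_pt _ _ (p 0 1)) pt_eta.
  have aux (h d x : R) : 2 * h + x * d = 0 -> h = x * - d / 2.
    by move=> e; apply/eqP; rewrite -subr_eq0; apply/eqP; lra.
  exact: aux.
apply: beaks_of_diagonal => //.
  apply: filterS2 KSig nz => p e np; rewrite /H2 e n_foot n_diag.
  have aux (x m : R) : m != 0 -> x * m / 2 / m = x / 2 by move=> m0; field; exact: m0.
  exact: aux.
have md := mdiag.
have h1 := near_comp mSd.1 mSd.2 (germ_near sH).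
have h2 := near_comp mdiag.1 mdiag.2 (germ_near ssig).
have max_d := map_germ_comp mdiag max.
have h3 := near_comp max_d.1 max_d.2 (germ_near srho).
have mfd : map_germ (fun p => foot (diag p)).
  exact: (map_germ_comp mdiag (conj sfoot foot0)).
have h4 := near_comp mfd.1 mfd.2 (germ_near sni).
apply: filterS3 (filterI h1 h2) (filterI h3 h4) nz => p [dHp dsp] [drp dnp] np.
set q := diag p.
have [_ dsig2] := der_comp (der_cst 0 q (pt 0 1)) (der_coord q (pt 0 1) 0) drp.
have dsig2' : 'D_(pt 0 1) sig q = 0.
  by apply: etrans dsig2 _; rewrite ptE !mul0r addr0.
have dH1q := der_comp (derP (pt 0 1) dsp) (der_coord q (pt 0 1) 1) dHp.
have dfq : der ((fun p => (n p)^-1) \o @foot R) q (pt 0 1) 0.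
  split; last by rewrite (derive_foot _ dnp) ptE mul0r.
  exact: (@differentiable_comp _ _ _ _ (@foot R) (fun p => (n p)^-1) q
    (differentiable_foot q) dnp).
have [_ e] := der_mul dH1q dfq.
have Hd : d2 H (pt (sig q) (q 0 1)) = - n p by rewrite /n opprK.
rewrite dsig2' Hd pt1 mulr0 add0r mul0r add0r mul1r /= n_foot n_diag mulrN in e.
by apply: etrans e _; rewrite mulVf.
Qed.

End Beaks.

(** * Criminant branches and their tangent lines *)

Section Types.
Context {R : realType}.
Implicit Types V W M : normedModType R.

(** A product of two germs that both vanish at 0 has zero differential. *)
Lemma irreducible_submersion (b : plane R -> R) v : smooth_germ b -> b 0 = 0 ->
  'd b (0 : plane R) v != 0 -> irreducible_germ b.
Proof.
move=> sb b0 db; split=> // a c sa sc e.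
apply: contrapT => /not_orP[/contrapT a0 /contrapT c0].
have [dac H] := der_mul (derP v (germ_diff sa)) (derP v (germ_diff sc)).
move/negP: db; apply; rewrite -deriveE; last exact: germ_diff.
by rewrite (near_eq_derive v e) H a0 c0 !mul0r addr0.
Qed.

Lemma diff_chain {W} (phi : plane R -> plane R) (b : plane R -> W) w :
  map_germ phi -> smooth_germ b ->
  'd b (0 : plane R) ('d phi (0 : plane R) w) = 'D_w (fun p => b (phi p)) (0 : plane R).
Proof.
move=> [sp p0] sb; have db : differentiable b (phi 0) by rewrite p0; exact: germ_diff.
have dp := germ_diff sp.
have := derive_comp w dp db; rewrite p0 => e.
by apply: etrans (esym e); rewrite (deriveE w dp).
Qed.

Lemma diffeo_diffK (phi phi' : plane R -> plane R) v : inverse_diffeo_germs phi phi' ->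
  'd phi (0 : plane R) ('d phi' (0 : plane R) v) = v.
Proof.
move=> [mp mp' _ e]; rewrite diff_chain //; last exact: mp.1.
by rewrite (near_eq_derive _ e) derive_id.
Qed.

Lemma map_germ_I : map_germ (@normal_form_I R).
Proof.
have s0 := @germ_coord R 0; have s1 := @germ_coord R 1.
apply: map_germ_pt; rewrite ?mxE ?addr0 ?expr0n //; first exact: germ_add.
exact: germ_exp.
Qed.

Lemma map_germ_II : map_germ (@normal_form_II R).
Proof.
have s0 := @germ_coord R 0; have s1 := @germ_coord R 1.
apply: map_germ_pt; rewrite ?mxE ?addr0 ?mulr0 //; first exact: germ_add.
by apply: germ_mul => //; exact: germ_exp.
Qed.

Lemma der_sq (p v : plane R) : der (fun q : plane R => q 0 1 ^+ 2) p v (2 * p 0 1 * v 0 1).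
Proof.
have -> : (fun q : plane R => q 0 1 ^+ 2) = (fun q => q 0 1 * q 0 1).
  by apply/funext => q; rewrite expr2.
by apply: der_eq (der_mul (der_coord p v 1) (der_coord p v 1)) _; ring.
Qed.

Lemma der_normal_fst (p v : plane R) :
  der (fun q : plane R => q 0 0 + q 0 1) p v (v 0 0 + v 0 1).
Proof. exact: der_add (der_coord p v 0) (der_coord p v 1). Qed.

Lemma criminant_pt (a b : plane R -> R) p a1 a2 b1 b2 :
  der a p (pt 1 0) a1 -> der a p (pt 0 1) a2 ->
  der b p (pt 1 0) b1 -> der b p (pt 0 1) b2 ->
  criminant_eq (fun q => pt (a q) (b q)) p = a1 * b2 - b1 * a2.
Proof.
move=> [da <-] [_ <-] [db <-] [_ <-].
rewrite criminant_eqE; last exact: differentiable_pt.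
have -> : (fun q => pt (a q) (b q) 0 0) = a by apply/funext => q; rewrite ptE.
by have -> : (fun q => pt (a q) (b q) 0 1) = b by apply/funext => q; rewrite ptE.
Qed.

Lemma criminant_I p : criminant_eq (@normal_form_I R) p = 2 * p 0 1.
Proof.
rewrite (criminant_pt (der_normal_fst p _) (der_normal_fst p _) (der_sq p _) (der_sq p _)).
by rewrite !ptE; ring.
Qed.

Lemma criminant_II p :
  criminant_eq (@normal_form_II R) p = p 0 1 * (2 * p 0 0 - p 0 1).
Proof.
have H v := der_mul (der_sq p v) (der_coord p v 0).
rewrite (criminant_pt (der_normal_fst p _) (der_normal_fst p _) (H _) (H _)).
by rewrite !ptE; ring.
Qed.

Lemma first_type_of_I (f : plane R -> plane R) : singularity_I f -> first_type f.
Proof.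
move=> [phi [phi' [psi [psi' [dphi dpsi e]]]]].
have [u [su u0 hu]] := criminant_transfer map_germ_I dphi dpsi e.
have [mphi mphi' hid _] := dphi.
pose b (p : plane R) := phi' p 0 1.
have sb : smooth_germ b by exact: germ_coordf mphi'.1.
exists (fun=> b); split.
  move=> _; apply: (@irreducible_submersion b ('d phi (0 : plane R) (pt 0 1))) => //.
    by rewrite /b mphi'.2 mxE.
  rewrite diff_chain //.
  have -> : 'D_(pt 0 1) (fun p => b (phi p)) (0 : plane R) =
            'D_(pt 0 1) (fun p : plane R => p 0 1) (0 : plane R).
    by apply: near_eq_derive; apply: filterS hid => p; rewrite /b => ->.
  by rewrite derive_coord_plane ptE oner_neq0.
exists (fun p => u p * 2); split.
- by apply: germ_mul => //; exact: germ_cst.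
- by apply/eqP; rewrite mulf_neq0 // pnatr_eq0.
- by apply: filterS hu => p ->; rewrite big_ord_recl big_ord0 mulr1 criminant_I mulrA.
Qed.

Lemma graph_diff (f : plane R -> plane R) v : map_germ f ->
  'd (graph_param f) (0 : plane R) v = (v 0 0 *: d_xi f 0, 'd f (0 : plane R) v).
Proof.
move=> [sf f0]; have df := germ_diff sf.
have foot0 : foot (0 : plane R) = 0 by rewrite /foot mxE pt00.
have df' : differentiable f (foot (0 : plane R)) by rewrite foot0.
have dfoot := @differentiable_foot R 0.
have dff : differentiable (f \o @foot R) 0 by exact: differentiable_comp.
have dG : differentiable (graph_param f) 0 by exact: differentiable_pair dff df.
rewrite -(deriveE v dG) [LHS]surjective_pairing.
rewrite -(derive_clin_comp v clin_fst dG) -(derive_clin_comp v clin_snd dG).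
congr pair; last by rewrite -(deriveE v df).
rewrite -[LHS]/('D_v (f \o @foot R) (0 : plane R)) (derive_comp v dfoot df') foot0.
have -> : 'D_v (@foot R) 0 = v 0 0 *: pt 1 0.
  apply: plane_ext; rewrite (derive_coord _ _ dfoot) ?ptZ ?ptE ?mulr1 ?mulr0.
    rewrite -(derive_coord_plane 0 v 0); congr ('D_v _ 0).
    by apply/funext => q; rewrite ptE.
  rewrite -(derive_cst (0 : R) (0 : plane R) v); congr ('D_v _ 0).
  by apply/funext => q; rewrite ptE.
by rewrite linearZ /d_xi deriveE.
Qed.

(** The first component of the graph sees the direction xi, the second one the
    direction t.  Hence tangent vectors of the graph can be handled through
    their coordinates in the source plane. *)
Lemma graph_immersion (f : plane R -> plane R) v : tangential_family_germ f ->
  'd (graph_param f) (0 : plane R) v = 0 -> v = 0.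
Proof.
move=> [mf _ tan _]; have [xi0 t0 _] := nbhs_singleton tan.
rewrite pt00 in xi0 t0.
rewrite graph_diff // => -[h1 h2].
have v0 : v 0 0 = 0.
  move/eqP: h1; rewrite scaler_eq0 => /orP[/eqP //|/eqP h]; by case: xi0.
have ve : v = v 0 1 *: pt 0 1 by rewrite ptZ mulr0 mulr1 -{1}(pt_eta v) v0.
have : v 0 1 *: d_t f 0 = 0.
  by rewrite /d_t deriveE -?linearZ -?ve //; exact: germ_diff mf.1.
move/eqP; rewrite scaler_eq0 => /orP[/eqP v1|/eqP h]; last by case: t0.
by rewrite ve v1 scale0r.
Qed.

Lemma graph_diff_inj (f : plane R -> plane R) v w : tangential_family_germ f ->
  'd (graph_param f) (0 : plane R) v = 'd (graph_param f) (0 : plane R) w -> v = w.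
Proof.
move=> hf e; apply/eqP; rewrite -subr_eq0; apply/eqP; apply: (graph_immersion hf).
by rewrite linearB e subrr.
Qed.

Lemma transversal_branchesP (f : plane R -> plane R) b1 b2 : tangential_family_germ f ->
  transversal_branches f b1 b2 <->
  forall v, exists v1 v2, [/\ 'd b1 (0 : plane R) v1 = 0, 'd b2 (0 : plane R) v2 = 0
                           & v = v1 + v2].
Proof.
move=> hf; split=> [tr v|H].
  have : graph_tangent f ('d (graph_param f) (0 : plane R) v) by exists v.
  rewrite tr => -[w1 [w2 [[v1 h1 <-] [v2 h2 <-] e]]].
  exists v1, v2; split=> //; apply: (graph_diff_inj hf).
  by rewrite linearD.
apply/seteqP; split=> [w [v _ <-]|w [w1 [w2 [[v1 h1 <-] [v2 h2 <-] ->]]]].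
  have [v1 [v2 [h1 h2 ->]]] := H v.
  exists ('d (graph_param f) (0 : plane R) v1), ('d (graph_param f) (0 : plane R) v2).
  by split; [exists v1|exists v2|rewrite linearD].
by exists (v1 + v2) => //; rewrite linearD.
Qed.

Lemma linear_kernel_line {W} (l : {linear plane R -> W}) k v : k != 0 -> l k = 0 ->
  l v = 0 -> (exists u, l u <> 0) -> exists c, v = c *: k.
Proof.
move=> k0 lk lv [u lu].
have D0 : k 0 0 * v 0 1 - k 0 1 * v 0 0 = 0.
  apply: contra_notP lu => /eqP D0.
  set D := k 0 0 * _ - _ in D0.
  have -> : u = ((u 0 0 * v 0 1 - u 0 1 * v 0 0) / D) *: k
              + ((k 0 0 * u 0 1 - k 0 1 * u 0 0) / D) *: v.
    apply: plane_ext; rewrite !mxE; move: D0; rewrite /D => D0; field; exact: D0.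
  by rewrite linearD !linearZ /= lk lv !scaler0 addr0.
have [k00|k00] := eqVneq (k 0 0) 0; last first.
  exists (v 0 0 / k 0 0); apply: plane_ext; rewrite !mxE; first by rewrite divfK.
  apply: (mulfI k00); rewrite mulrA mulrCA divff // mulr1.
  by apply/eqP; rewrite mulrC -subr_eq0 [_ * k 0 1]mulrC mulrC D0.
have k01 : k 0 1 != 0.
  by apply: contra_neq k0 => k01; apply: plane_ext; rewrite mxE.
exists (v 0 1 / k 0 1); apply: plane_ext; rewrite !mxE; last by rewrite divfK.
rewrite k00 mulr0; move/eqP: D0.
by rewrite k00 mul0r sub0r oppr_eq0 mulf_eq0 (negbTE k01) => /eqP.
Qed.

Lemma diff_scale0 {W} (f : plane R -> W) c k :
  'd f (0 : plane R) k = 0 -> 'd f (0 : plane R) (c *: k) = 0.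
Proof. by move=> h; rewrite linearZ h; exact: scaler0. Qed.

Lemma nonvertical_branch (f : plane R -> plane R) b k : tangential_family_germ f ->
  'd f (0 : plane R) k = 0 -> 'd b (0 : plane R) k != 0 -> ~ vertical_branch f b.
Proof.
move=> hf fk bk vb; have [mf _ _ _] := hf.
have : vertical_direction f ('d (graph_param f) (0 : plane R) k).
  by split; [exists k|rewrite graph_diff].
rewrite -vb => -[v bv /(graph_diff_inj hf) e]; move/negP: bk; apply.
by rewrite -e; apply/eqP.
Qed.

(** The differential of f at the origin has rank at least one, so its kernel is
    the line spanned by k; if the tangent line of the branch contained k, it
    would be that same line. *)
Lemma nonvertical_branchP (f : plane R -> plane R) b k : tangential_family_germ f ->
  smooth_branch b -> ~ vertical_branch f b -> k != 0 ->
  'd f (0 : plane R) k = 0 -> 'd b (0 : plane R) k != 0.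
Proof.
move=> hf sb nv k0 fk; apply/eqP => bk; apply: nv.
have [mf _ tan _] := hf; have [_ t0 _] := nbhs_singleton tan; rewrite pt00 in t0.
have fu : exists u, 'd f (0 : plane R) u <> 0.
  by exists (pt 0 1); rewrite -deriveE //; exact: germ_diff mf.1.
apply/seteqP; split=> [w [v bv <-]|w [[v _ <-]]].
  split; first by exists v.
  have [c ->] := linear_kernel_line k0 bk bv sb.
  by rewrite graph_diff // /pi2 /=; exact: diff_scale0.
rewrite graph_diff // /pi2 /= => fv; exists v; last by rewrite graph_diff.
have [c ->] := linear_kernel_line k0 fk fv fu.
exact: diff_scale0.
Qed.

End Types.

(** * The types characterize the singularities *)

Section Main.
Context {R : realType}.
Implicit Types V W M : normedModType R.

Lemma derive_chain0 (g psi : plane R -> plane R) v : map_germ g -> smooth_germ psi ->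
  'D_v g (0 : plane R) = 0 -> 'D_v (fun p => psi (g p)) (0 : plane R) = 0.
Proof.
move=> mg sp e; have dg := germ_diff mg.1; have e' := etrans (esym (deriveE v dg)) e.
apply: etrans (esym (diff_chain v mg sp)) _.
apply: etrans (congr1 ('d psi (0 : plane R)) e') _; exact: linear0.
Qed.

Lemma derive_pt (a b : plane R -> R) p v da db : der a p v da -> der b p v db ->
  'D_v (fun q => pt (a q) (b q)) p = pt da db.
Proof.
move=> [ha <-] [hb <-]; have d := differentiable_pt ha hb.
apply: plane_ext; rewrite (derive_coord _ _ d) ptE; congr ('D_v _ p).
  by apply/funext => q; rewrite ptE.
by apply/funext => q; rewrite ptE.
Qed.

(** The branches are the pullbacks by phi' of the two lines of [criminant_II].
    Their tangent lines and the vertical direction k are computed in the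
    source plane of the normal form, where the vertical direction is
    (1, -1). *)
Lemma second_type_of_II (f : plane R -> plane R) : tangential_family_germ f ->
  singularity_II f -> second_type f.
Proof.
move=> hf [phi [phi' [psi [psi' [dphi dpsi e]]]]]; have [mf _ _ _] := hf.
have [u [su u0 hu]] := criminant_transfer map_germ_II dphi dpsi e.
have [mphi mphi' hid _] := dphi; have [mpsi _ _ _] := dpsi.
pose b0 (p : plane R) := phi' p 0 1.
pose b1 (p : plane R) := 2 * phi' p 0 0 - phi' p 0 1.
have sb0 : smooth_germ b0 by exact: germ_coordf mphi'.1.
have sb1 : smooth_germ b1.
  apply: germ_add; last by apply: germ_opp.
  by apply: germ_mul; [exact: germ_cst|exact: germ_coordf mphi'.1].
have b00 : b0 0 = 0 by rewrite /b0 mphi'.2 mxE.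
have b10 : b1 0 = 0 by rewrite /b1 mphi'.2 !mxE; ring.
have db0 w : 'd b0 (0 : plane R) ('d phi (0 : plane R) w) = w 0 1.
  rewrite diff_chain // -(derive_coord_plane 0 w 1); apply: near_eq_derive.
  by apply: filterS hid => p; rewrite /b0 => ->.
have db1 w : 'd b1 (0 : plane R) ('d phi (0 : plane R) w) = 2 * w 0 0 - w 0 1.
  rewrite diff_chain //.
  have [_ H] := der_add (der_mul (der_cst 2 0 w) (der_coord 0 w 0)) (der_opp (der_coord 0 w 1)).
  rewrite mulr0 addr0 in H; rewrite -H; apply: near_eq_derive.
  by apply: filterS hid => p; rewrite /b1 => ->.
pose k := 'd phi (0 : plane R) (pt 1 (-1)).
have fk : 'd f (0 : plane R) k = 0.
  rewrite diff_chain //; last exact: mf.1.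
  have -> : 'D_(pt 1 (-1)) (fun p => f (phi p)) (0 : plane R) =
            'D_(pt 1 (-1)) (fun p => psi (normal_form_II p)) (0 : plane R).
    apply: near_eq_derive; apply: filterS2 hid (near_comp mphi.1 mphi.2 e) => p.
    by move=> h ->; rewrite h.
  apply: derive_chain0 (@map_germ_II R) mpsi.1 _.
  have h := derive_pt (der_normal_fst 0 (pt 1 (-1)))
    (der_mul (der_sq 0 (pt 1 (-1))) (der_coord 0 (pt 1 (-1)) 0)).
  by apply: etrans h _; rewrite !ptE !mxE expr0n /= subrr !mul0r addr0 pt00.
pose b (i : 'I_2) := if i == 0 then b0 else b1.
exists b; split.
- split.
    move=> i; rewrite /b; case: ifP => _.
      apply: (irreducible_submersion sb0 b00 (v := k)).
      by rewrite db0 ptE oppr_eq0 oner_neq0.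
    apply: (irreducible_submersion sb1 b10 (v := k)).
    by rewrite db1 !ptE mulr1 opprK natr1 pnatr_eq0.
  exists u; split=> //; first exact/eqP.
  apply: filterS hu => p ->; rewrite !big_ord_recl big_ord0 mulr1 criminant_II.
  by [].
- move=> i; exists k; rewrite /b; case: ifP => _.
    by rewrite db0 ptE; apply/eqP; rewrite oppr_eq0 oner_neq0.
  by rewrite db1 !ptE mulr1 opprK natr1; apply/eqP; rewrite pnatr_eq0.
- apply/transversal_branchesP => // v; rewrite /b /=.
  pose y := 'd phi' (0 : plane R) v.
  exists ('d phi (0 : plane R) (pt (y 0 0 - y 0 1 / 2) 0)).
  exists ('d phi (0 : plane R) (pt (y 0 1 / 2) (y 0 1))); split.
  + by rewrite db0 ptE.
  + by rewrite db1 !ptE; field.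
  + rewrite -linearD ptD subrK add0r pt_eta.
    by rewrite (diffeo_diffK _ dphi).
- move=> i; apply: (nonvertical_branch hf fk); rewrite /b; case: ifP => _.
    by rewrite db0 ptE oppr_eq0 oner_neq0.
  by rewrite db1 !ptE mulr1 opprK natr1 pnatr_eq0.
Qed.

(** The derivative of t^2 H along t is t times this factor. *)
Definition criminant_factor (H : plane R -> R) (p : plane R) := 2 * H p + p 0 1 * d2 H p.

Lemma germ_criminant_factor H : smooth_germ H -> smooth_germ (criminant_factor H).
Proof.
move=> sH; apply: germ_add; first by apply: germ_mul => //; exact: germ_cst.
by apply: germ_mul; [exact: germ_coord|exact: germ_D].
Qed.

Lemma map_germ_prenormal (H : plane R -> R) : smooth_germ H -> map_germ (prenormal H).
Proof.
move=> sH; apply: map_germ_pt; rewrite ?mxE ?expr0n ?mul0r //; first exact: germ_coord.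
by apply: germ_mul => //; apply: germ_exp; exact: germ_coord.
Qed.

Lemma criminant_prenormal (H : plane R -> R) : smooth_germ H ->
  \forall p \near (0 : plane R),
    criminant_eq (prenormal H) p = (p : plane R) 0 1 * criminant_factor H p.
Proof.
move=> sH; apply: filterS (germ_near sH) => p dH.
have D v := der_mul (der_sq p v) (derP v dH).
rewrite (criminant_pt (der_coord p _ 0) (der_coord p _ 0) (D _) (D _)).
rewrite !ptE /criminant_factor -/(d2 H p); ring.
Qed.

(** In prenormal coordinates the Jacobian determinant is t K.  As t vanishes at
    the origin, irreducibility forces K (0) = 2 H (0) to be nonzero. *)
Lemma I_of_first_type (f : plane R -> plane R) : tangential_family_germ f ->
  first_type f -> singularity_I f.
Proof.
move=> hf [b [irr [U [sU U0 hU]]]]; have [mf _ _ _] := hf.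
have [phi [phi' [psi [psi' [H [dphi dpsi sH e]]]]]] := prenormalize hf.
have e' : \forall p \near (0 : plane R), prenormal H p = psi (f (phi' p)).
  by apply: filterS e => p ->.
have fH : A_equivalent f (prenormal H) by exists phi, phi', psi, psi'; split.
have [u [su u0 hu]] := criminant_transfer mf dphi dpsi e'.
have [mphi mphi' hid _] := dphi.
have [sb b0 hb] := irr ord0.
pose a p := phi p 0 1.
pose g p := u (phi p) * U p.
have sg : smooth_germ g by apply: germ_mul => //; exact: (germ_comp mphi.1 mphi.2 su).
have g0 : g 0 != 0 by rewrite /g mphi.2 mulf_neq0 //; exact/eqP.
pose c p := criminant_factor H (phi p) * (g p)^-1.
have sa : smooth_germ a by exact: germ_coordf mphi.1.
have sc : smooth_germ c.
  apply: germ_mul; last exact: germ_inv.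
  exact: (germ_comp mphi.1 mphi.2 (germ_criminant_factor sH)).
(* A factorization of b in which the first factor is the pullback of t. *)
have bac : \forall p \near (0 : plane R), b ord0 p = a p * c p.
  have n1 := near_comp mphi.1 mphi.2 (criminant_prenormal sH).
  have n2 := near_comp mphi.1 mphi.2 hu.
  have n3 := germ_near_neq0 sg g0.
  apply: filterS3 (filterI n1 n2) (filterI hid hU) n3 => p [h1 h2] [h3 h4] h5.
  have E : a p * criminant_factor H (phi p) = g p * b ord0 p.
    by rewrite /a -h1 h2 h3 h4 big_ord_recl big_ord0 mulr1 mulrA.
  by rewrite /c mulrA E mulrC mulKf.
have a0 : a 0 = 0 by rewrite /a mphi.2 mxE.
have H0 : H 0 != 0.
  case: (hb a c sa sc bac) => // c0; apply/eqP => H0; apply: c0.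
  by rewrite /c mphi.2 /criminant_factor H0 mxE mulr0 mul0r addr0 mul0r.
exact: A_equivalent_trans (prenormal_fold sH H0) (A_equivalent_sym mf fH).
Qed.

Lemma derive2_product (a c : plane R -> R) v : smooth_germ a -> smooth_germ c ->
  a 0 = 0 -> c 0 = 0 ->
  'D_v (fun p => 'D_v (fun q => a q * c q) p) (0 : plane R) = 2 * ('D_v a 0 * 'D_v c 0).
Proof.
move=> sa sc a0 c0.
have E : \forall p \near (0 : plane R),
    'D_v (fun q => a q * c q) p = a p * 'D_v c p + c p * 'D_v a p.
  apply: filterS2 (germ_near sa) (germ_near sc) => p da dc.
  by have [_ ->] := der_mul (derP v da) (derP v dc).
rewrite (near_eq_derive v E).
have da := derP v (germ_diff sa); have dc := derP v (germ_diff sc).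
have dda := derP v (germ_diff (germ_D v sa)); have ddc := derP v (germ_diff (germ_D v sc)).
have [_ ->] := der_add (der_mul da ddc) (der_mul dc dda).
have aux (x y z t s r : R) : s = 0 -> r = 0 ->
    s * z + y * x + (r * t + x * y) = 2 * (x * y) by move=> -> ->; ring.
exact: aux a0 c0.
Qed.

(** The two sides are binary quadratic forms in (x, y).  The left one vanishes
    only on the line y = 0, so both linear factors on the right are
    proportional to y. *)
Lemma parallel_factors (K2 w a0 c0 a1 c1 : R) : w != 0 -> c0 != 0 -> c1 != 0 ->
  (forall x y, y * (y * K2) = w * (x * a0 + y * c0) * (x * a1 + y * c1)) ->
  a0 = 0 /\ a1 = 0.
Proof.
move=> w0 hc0 hc1 E.
have E1 := E 1 0; have E2 := E 1 1; have E3 := E 1 (-1).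
have P : a0 * a1 = 0.
  apply: (mulfI w0); rewrite mulr0; apply/eqP; rewrite eq_sym -subr_eq0; apply/eqP.
  rewrite (_ : 0 - _ = 0 * (0 * K2) - w * (1 * a0 + 0 * c0) * (1 * a1 + 0 * c1)).
    by rewrite E1 subrr.
  by ring.
have S : a0 * c1 + c0 * a1 = 0.
  have w2 : 2 * w != 0 by rewrite mulf_neq0 // pnatr_eq0.
  apply: (mulfI w2); rewrite mulr0.
  rewrite (_ : 2 * w * _ = w * (1 * a0 + 1 * c0) * (1 * a1 + 1 * c1)
                         - w * (1 * a0 + -1 * c0) * (1 * a1 + -1 * c1)); last by ring.
  by rewrite -E2 -E3; ring.
move/eqP: P; rewrite mulf_eq0 => /orP[/eqP h|/eqP h]; rewrite h ?mul0r ?mulr0 ?add0r ?addr0 in S.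
  by split=> //; move/eqP: S; rewrite mulf_eq0 (negbTE hc0) => /eqP.
by split=> //; move/eqP: S; rewrite mulf_eq0 (negbTE hc1) orbF => /eqP.
Qed.

(** In prenormal coordinates t K = w beta_0 beta_1, with w nonvanishing and beta_i
    the equations of the two branches.  First derivatives give K (0) = 0, and
    second derivatives give dt dK = w (0) dbeta_0 dbeta_1 as quadratic forms.
    The vertical direction is the t-axis, where the right-hand side does
    not vanish since no branch is vertical: hence K_t is nonzero.  If
    K_x vanished, the left-hand side would be a multiple of dt^2 and both
    branches would be tangent to t = 0, against transversality.  Since
    K_x (0) = 2 H_x (0) and K_t (0) = 3 H_t (0), these are the hypotheses of
    [prenormal_beaks]. *)
Lemma II_of_second_type (f : plane R -> plane R) : tangential_family_germ f ->
  second_type f -> singularity_II f.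
Proof.
move=> hf [b [[irr [U [sU U0 hU]]] smb trb nvb]]; have [mf _ _ _] := hf.
have [phi [phi' [psi [psi' [H [dphi dpsi sH e]]]]]] := prenormalize hf.
have e' : \forall p \near (0 : plane R), prenormal H p = psi (f (phi' p)).
  by apply: filterS e => p ->.
have fH : A_equivalent f (prenormal H) by exists phi, phi', psi, psi'; split.
have [u [su u0 hu]] := criminant_transfer mf dphi dpsi e'.
have [mphi mphi' hid hid'] := dphi; have [mpsi mpsi' hpsi _] := dpsi.
pose K := criminant_factor H; have sK : smooth_germ K := germ_criminant_factor sH.
pose beta i p := b i (phi' p).
have sbeta i : smooth_germ (beta i).
  by have [sb _ _] := irr i; exact: (germ_comp mphi'.1 mphi'.2 sb).
have beta0 i : beta i 0 = 0 by have [_ b0 _] := irr i; rewrite /beta mphi'.2.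
pose w p := u p * U (phi' p).
have sw : smooth_germ w by apply: germ_mul => //; exact: (germ_comp mphi'.1 mphi'.2 sU).
have w0 : w 0 != 0 by rewrite /w mphi'.2 mulf_neq0 //; exact/eqP.
pose wb p := w p * beta 0 p.
have swb : smooth_germ wb by exact: germ_mul.
have wb0 : wb 0 = 0 by rewrite /wb beta0 mulr0.
have E : \forall p \near (0 : plane R), (p : plane R) 0 1 * K p = wb p * beta 1 p.
  apply: filterS3 (criminant_prenormal sH) hu (near_comp mphi'.1 mphi'.2 hU).
  move=> p h1 h2 h3; rewrite -h1 h2 h3 !big_ord_recl big_ord0 mulr1 /wb /w /beta.
  have -> : lift ord0 ord0 = 1 :> 'I_2 by apply: val_inj.
  by rewrite !mulrA.
have z0 : (0 : plane R) 0 1 = 0 by rewrite mxE.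
have dD v (g : plane R -> R) : smooth_germ g -> der g 0 v (v 0 0 * d1 g 0 + v 0 1 * d2 g 0).
  by move=> sg; have dg := germ_diff sg; split=> //; exact: derive_dir.
have K0 : K 0 = 0.
  have [_ h1] := der_mul (der_coord 0 (pt 0 1) 1) (derP (pt 0 1) (germ_diff sK)).
  have [_ h2] := der_mul (derP (pt 0 1) (germ_diff swb)) (derP (pt 0 1) (germ_diff (sbeta 1))).
  have := near_eq_derive (pt 0 1) E; rewrite h1 h2.
  by rewrite z0 wb0 beta0 !mul0r ptE mulr1 !add0r.
have H0 : H 0 = 0.
  move: K0; rewrite /K /criminant_factor z0 mul0r addr0 => /eqP.
  by rewrite mulf_eq0 pnatr_eq0 /= => /eqP.
have DK v : 'D_v K 0 = 2 * 'D_v H 0 + v 0 1 * d2 H 0.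
  have sH2 := germ_D (pt 0 1) sH.
  have [_ h] := der_add (der_mul (der_cst 2 0 v) (derP v (germ_diff sH)))
    (der_mul (der_coord 0 v 1) (derP v (germ_diff sH2))).
  apply: etrans h _; rewrite z0 mul0r mulr0 addr0 add0r [X in _ + X]mulrC.
  by [].
(* The equality dt dK = w (0) dbeta_0 dbeta_1 of quadratic forms. *)
have Q (v : plane R) : v 0 1 * 'D_v K 0 = w 0 * 'D_v (beta 0) 0 * 'D_v (beta 1) 0.
  have h1 := derive2_product v (@germ_coord R 1) sK z0 K0.
  have h2 := derive2_product v swb (sbeta 1) wb0 (beta0 1).
  have h3 : \forall p \near (0 : plane R), 'D_v (fun q : plane R => q 0 1 * K q) p
      = 'D_v (fun q => wb q * beta 1 q) p.
    by apply: filterS (near_open_near E) => p; exact: near_eq_derive.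
  have h4 := near_eq_derive v h3.
  have [_ h5] := der_mul (derP v (germ_diff sw)) (derP v (germ_diff (sbeta 0))).
  rewrite beta0 mul0r addr0 in h5.
  have n2 : (2 : R) != 0 by rewrite pnatr_eq0.
  apply: (mulfI n2); rewrite -[in LHS](derive_coord_plane 0 v 1).
  apply: etrans (esym h1) _; apply: etrans h4 _; apply: etrans h2 _.
  by congr (_ * (_ * _)); exact: h5.
have Dbeta i v : 'D_v (beta i) 0 = 'd (b i) (0 : plane R) ('d phi' (0 : plane R) v).
  by have [sb _ _] := irr i; rewrite (diff_chain _ mphi' sb).
pose k := 'd phi' (0 : plane R) (pt 0 1).
have phik : 'd phi (0 : plane R) k = pt 0 1 by exact: diffeo_diffK.
have k0 : k != 0.
  apply/eqP => k0; move: phik; rewrite k0 linear0 => h.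
  by have := congr1 (fun q : plane R => q 0 1) h; rewrite ptE mxE => /esym/eqP; rewrite oner_eq0.
have fk : 'd f (0 : plane R) k = 0.
  rewrite (diff_chain _ mphi' mf.1).
  have mff := map_germ_comp mphi' mf.
  have -> : 'D_(pt 0 1) (fun p => f (phi' p)) (0 : plane R) =
            'D_(pt 0 1) (fun p => psi' (prenormal H p)) (0 : plane R).
    apply: near_eq_derive; apply: filterS2 e (near_comp mff.1 mff.2 hpsi) => p h1 h2.
    by rewrite -h1; apply/esym; exact: h2.
  apply: derive_chain0 (map_germ_prenormal sH) mpsi'.1 _.
  have h := derive_pt (der_coord 0 (pt 0 1) 0)
    (der_mul (der_sq 0 (pt 0 1)) (derP (pt 0 1) (germ_diff sH))).
  by apply: etrans h _; rewrite !ptE z0 expr0n /= mulr0 !mul0r mulr0 addr0 pt00.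
have c i : d2 (beta i) 0 != 0.
  by rewrite /d2 Dbeta; exact: (nonvertical_branchP hf (smb i) (nvb i) k0 fk).
have dH2 : d2 H 0 != 0.
  have := Q (pt 0 1); rewrite DK ptE !mul1r => h.
  have : w 0 * d2 (beta 0) 0 * d2 (beta 1) 0 != 0.
    by apply: mulf_neq0; [apply: mulf_neq0|].
  by rewrite -[X in X != 0]h; apply: contra_neq => h2; rewrite -/(d2 H 0) h2 mulr0 addr0.
have dH1 : d1 H 0 != 0.
  apply/eqP => dH1.
  have dirs i (v : plane R) : 'D_v (beta i) 0 = v 0 0 * d1 (beta i) 0 + v 0 1 * d2 (beta i) 0.
    by have [_] := dD v _ (sbeta i).
  have [a0 a1] : d1 (beta 0) 0 = 0 /\ d1 (beta 1) 0 = 0.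
    apply: (@parallel_factors (3 * d2 H 0) (w 0) _ (d2 (beta 0) 0) _ (d2 (beta 1) 0)) => // x y.
    have := Q (pt x y); rewrite DK !dirs; have [_ ->] := dD (pt x y) _ sH.
    rewrite dH1 !ptE => <-; ring.
  have line i (v : plane R) : 'd (b i) (0 : plane R) v = 0 -> d1 (beta i) 0 = 0 ->
      ('d phi (0 : plane R) v) 0 1 = 0.
    move=> bv ai; set y := 'd phi (0 : plane R) v.
    have hy : 'd phi' (0 : plane R) y = v := diffeo_diffK v (diffeo_sym dphi).
    have := etrans (Dbeta i y) (etrans (congr1 ('d (b i) (0 : plane R)) hy) bv).
    rewrite (dirs i y) ai mulr0 add0r => /eqP.
    by rewrite mulf_eq0 (negbTE (c i)) orbF => /eqP.
  have [v1 [v2 [h1 h2 hk]]] := (transversal_branchesP _ _ hf).1 trb k.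
  have := congr1 (fun q : plane R => q 0 1) phik; rewrite hk linearD mxE ptE.
  rewrite (line 0 _ h1 a0) (line 1 _ h2 a1) addr0 => /esym/eqP.
  by rewrite oner_eq0.
exact: A_equivalent_trans (prenormal_beaks sH H0 dH1 dH2) (A_equivalent_sym mf fH).
Qed.

End Main.

Theorem theorem2 (R : realType) (f : plane R -> plane R)
    (hf : tangential_family_germ f) :
  (singularity_I f <-> first_type f) /\ (singularity_II f <-> second_type f).
Proof.
split; split.
- exact: first_type_of_I.
- exact: I_of_first_type.
- exact: second_type_of_II.
- exact: II_of_second_type.
Qed.
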